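(* For any graphs $G$ and $H$, the graph state $|G\rangle$ can be generated from the graph state $|H\rangle$ with CZ-complexity at most $t$ if and only if $G$ can be obtained from $H$ by vertex deletions, local complementations and at most $t$ elementary edge-complementations.
   Context: Graphs are finite, simple and undirected; $N_G(v)$ denotes the neighborhood of $v$ in $G$, and $\binom V2$ the family of two-element subsets of $V$. The Pauli group $\mathcal{G}_n$ consists of all $\alpha h_1\otimes\dots\otimes h_n$ with $\alpha\in\{\pm1,\pm i\}$, $h_j\in\{I_2,X,Y,Z\}$. The $n$-qubit Clifford group is $\mathcal{C}_n=\{U\in U(2^n): U\mathcal{G}_nU^\dagger=\mathcal{G}_n\}$. For a graph $G=(V,E)$ with $V=\{1,\dots,n\}$, the graph state $|G\rangle$ is the $n$-qubit stabilizer state (unique up to global phase) that is fixed by $X_v\otimes\bigotimes_{w\in N_G(v)}Z_w$ for all $v\in V$, where the subscripts indicate the qubit acted on. Quantum algorithms: an algorithm consists of the following operations: (1) measurements of qubits in the computational basis (measured qubits are discarded); (2) single-qubit Clifford operations; (3) two-qubit Clifford operations. After measurements of some qubits, the algorithm may choose subsequent operations depending on the measurement outcomes. The CZ-complexity of an algorithm is the maximum, over measurement outcomes, of the number of two-qubit Clifford operations in it. ''$|G\rangle$ can be generated from $|H\rangle$ with CZ-complexity at most $t$'' means that some such algorithm of CZ-complexity at most $t$, started on $|H\rangle$, produces $|G\rangle$ with probability $1$. Graph operations. Local complementation at a vertex $v$ of $G=(V,E)$ replaces $G$ by $\tau_v(G)=(V,E\bigtriangleup\binom{N_G(v)}{2})$,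 where $\bigtriangleup$ is symmetric difference. An elementary edge-complementation on $G=(V,E)$ is any one of: (i) for $\{v,w\}\in\binom V2$, complement the edge $\{v,w\}$ (add it if absent, remove it if present); (ii) for $\{v,w\}\in\binom V2$, complement all edges between $v$ and $N_G(w)\setminus\{v\}$; (iii) for $\{v,w\}\in\binom V2\setminus E$, complement all edges in $\{\{x,y\}\in\binom V2: x\in N_G(v),\ y\in N_G(w),\ \{x,y\}\nsubseteq N_G(v)\cap N_G(w)\}$. *)

(* Defs.v *)
From HB Require Import structures.
From mathcomp Require Import all_boot all_order all_algebra.
From mathcomp Require Import spectral.
From mathcomp Require Import boolp complex.

Set Implicit Arguments.
Unset Strict Implicit.
Unset Printing Implicit Defensive.

Import Order.TTheory GRing.Theory Num.Theory.
Local Open Scope ring_scope.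
Local Open Scope sesquilinear_scope.

Record sgraph := SGraph {
  vertex :> finType;
  adj : rel vertex;
  adj_sym : symmetric adj;
  adj_irr : irreflexive adj }.

Definition nbh (G : sgraph) (v : G) : {set G} := [set w | adj v w].

Definition graph_iso (G H : sgraph) : Prop :=
  exists2 f : G -> H, bijective f & forall x y, adj (f x) (f y) = adj x y.

(* The graph (V, E symmetric-difference F); members of F that are not
   two-element sets are ignored. *)
Section EdgeComplement.
Variables (G : sgraph) (F : {set {set G}}).

Definition compl_adj : rel G :=
  fun x y => adj x y (+) ((x != y) && ([set x; y] \in F)).

Lemma compl_adj_sym : symmetric compl_adj.
Proof. by move=> x y; rewrite /compl_adj adj_sym eq_sym setUC. Qed.

Lemma compl_adj_irr : irreflexive compl_adj.
Proof. by move=> x; rewrite /compl_adj adj_irr eqxx. Qed.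

Definition edge_compl : sgraph := SGraph compl_adj_sym compl_adj_irr.
End EdgeComplement.

Section VertexDeletion.
Variables (G : sgraph) (v : G).

Definition del_adj : rel {x : G | x != v} := fun x y => adj (val x) (val y).

Lemma del_adj_sym : symmetric del_adj.
Proof. by move=> x y; apply: adj_sym. Qed.

Lemma del_adj_irr : irreflexive del_adj.
Proof. by move=> x; apply: adj_irr. Qed.

Definition vertex_del : sgraph := SGraph del_adj_sym del_adj_irr.
End VertexDeletion.

Definition local_compl (G : sgraph) (v : G) : sgraph :=
  edge_compl [set e : {set G} | (e \subset nbh v) && (#|e| == 2)%N].

Variant elementary_set (G : sgraph) : {set {set G}} -> Prop :=
| ElemEdge (v w : G) of v != w :
    elementary_set [set [set v; w]]
| ElemStar (v w : G) of v != w :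
    elementary_set [set [set v; x] | x in nbh w :\ v]
| ElemBip (v w : G) of v != w & ~~ adj v w :
    elementary_set [set e : {set G} | [&& #|e| == 2%N,
      [exists x in nbh v, exists y in nbh w, e == [set x; y]]
      & ~~ (e \subset nbh v :&: nbh w)]].

(* [obtained k H G]: G is obtained from H, up to isomorphism, by vertex
   deletions, local complementations and exactly k elementary
   edge-complementations, in any order. *)
Inductive obtained : nat -> sgraph -> sgraph -> Prop :=
| ObtIso (H G : sgraph) of graph_iso H G : obtained 0 H G
| ObtDel k (H G : sgraph) (v : H) of
    obtained k (vertex_del v) G : obtained k H G
| ObtLC k (H G : sgraph) (v : H) of
    obtained k (local_compl v) G : obtained k H G
| ObtElem k (H G : sgraph) (F : {set {set H}}) of
    elementary_set F & obtained k (edge_compl F) G : obtained k.+1 H G.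

Definition obtainable (t : nat) (H G : sgraph) : Prop :=
  exists2 k, (k <= t)%N & obtained k H G.

(* A register is a finite type V of qubits.  Its computational basis is
   indexed by the bit-strings V -> bool, which [enum_rank] and [enum_val] put in
   bijection with the row and column indices of matrices of size 2 ^ #|V|. *)
Notation bits V := {ffun V -> bool}.
Notation qdim V := #|{: bits V}|.

Section Quantum.
Variable C : numClosedFieldType.

Definition state (V : finType) := 'cV[C]_(qdim V).
Definition oper (V : finType) := 'M[C]_(qdim V).

Definition amp (V : finType) (psi : state V) (x : bits V) : C :=
  psi (enum_rank x) 0.
Definition mk_state (V : finType) (f : bits V -> C) : state V :=
  \col_i f (enum_val i).
Definition entry (V : finType) (A : oper V) (x y : bits V) : C :=
  A (enum_rank x) (enum_rank y).
Definition mk_oper (V : finType) (f : bits V -> bits V -> C) : oper V :=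
  \matrix_(i, j) f (enum_val i) (enum_val j).

Definition sqnorm (V : finType) (psi : state V) : C :=
  \sum_i `|psi i 0| ^+ 2.

Inductive pauli := PI | PX | PY | PZ.

Definition pauli_mx (p : pauli) (a b : bool) : C :=
  match p with
  | PI => (a == b)%:R
  | PX => (a != b)%:R
  | PY => if a == b then 0 else if a then 'i else - 'i
  | PZ => if a == b then (-1) ^+ a else 0
  end.

Definition pauli_tensor (V : finType) (h : V -> pauli) : oper V :=
  mk_oper (fun x y => \prod_(v : V) pauli_mx (h v) (x v) (y v)).

Definition pauli_group (V : finType) (A : oper V) : Prop :=
  exists2 alpha : C, alpha \in [:: 1; -1; 'i; - 'i]
    & exists h : V -> pauli, A = alpha *: pauli_tensor h.

Definition clifford_group (V : finType) (U : oper V) : Prop :=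
  U \is unitarymx /\
  (forall B : oper V, pauli_group B <->
     exists2 A, pauli_group A & B = U *m A *m U^t*).

Definition graph_stabilizer (G : sgraph) (v : G) : oper G :=
  pauli_tensor (fun w => if w == v then PX else if adj v w then PZ else PI).

(* The graph state is only defined up to a global phase, hence a predicate. *)
Definition graph_state (G : sgraph) (psi : state G) : Prop :=
  sqnorm psi = 1 /\ forall v : G, graph_stabilizer v *m psi = psi.

(* The action on register V of an operation U on k qubits, the i-th of which is
   [q i]; the qubits outside the range of q are left untouched. *)
Definition on_qubits k (V : finType) (q : 'I_k -> V) (U : oper 'I_k) : oper V :=
  mk_oper (fun x y =>
    if [forall w, (w \notin codom q) ==> (x w == y w)]
    then entry U [ffun i => x (q i)] [ffun i => y (q i)] else 0).

Definition on_qubit (V : finType) (v : V) : oper 'I_1 -> oper V :=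
  on_qubits (fun _ => v).

Definition on_pair (V : finType) (v w : V) : oper 'I_2 -> oper V :=
  on_qubits (fun i => if i == ord0 then v else w).

Definition extend_bits (V : finType) (v : V) (b : bool)
    (x : bits {w : V | w != v}) : bits V :=
  [ffun w => if insub w is Some w' then x w' else b].

(* <b| on qubit v, tensored with the identity on the other qubits; the result
   is the unnormalized state of the remaining register after outcome b. *)
Definition collapse (V : finType) (v : V) (b : bool) (psi : state V) :
    state {w : V | w != v} :=
  mk_state (fun x => amp psi (extend_bits b x)).

Definition normalize (V : finType) (psi : state V) : state V :=
  (sqrtC (sqnorm psi))^-1 *: psi.

(* An adaptive algorithm on register V: after a measurement, it continues on the
   remaining qubits in a way that depends on the outcome. *)
Inductive algorithm (V : finType) : Type :=
| Stop
| Clifford1 (v : V) (U : oper 'I_1) of clifford_group U & algorithm V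
| Clifford2 (v w : V) (U : oper 'I_2) of
    v != w & clifford_group U & algorithm V
| Measure (v : V) of (bool -> algorithm {w : V | w != v}).

Fixpoint cz_complexity (V : finType) (A : algorithm V) : nat :=
  match A with
  | Stop => 0
  | Clifford1 _ _ _ A' => cz_complexity A'
  | Clifford2 _ _ _ _ _ A' => (cz_complexity A').+1
  | Measure _ A' => maxn (cz_complexity (A' false)) (cz_complexity (A' true))
  end.

(* Renaming of the qubits of register V into the elements of W along f. *)
Definition rename (V W : finType) (f : V -> W) (psi : state V) : state W :=
  mk_state (fun x => amp psi [ffun v => x (f v)]).

(* [psi] is |G> when the qubit in position [iota g] plays the role of vertex g;
   [pos] gives the positions, in the initial register L, of the qubits of V. *)
Definition is_output (L : finType) (G : sgraph) (iota : G -> L)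
    (V : finType) (pos : V -> L) (psi : state V) : Prop :=
  exists f : V -> G, [/\ bijective f, forall v, iota (f v) = pos v
                       & graph_state (rename f psi)].

(* The probability that algorithm A, started on psi, outputs |G>. *)
Fixpoint success_prob (L : finType) (G : sgraph) (iota : G -> L)
    (V : finType) (A : algorithm V) : (V -> L) -> state V -> C :=
  match A with
  | Stop => fun pos psi => `[< is_output iota pos psi >]%:R
  | Clifford1 v U _ A' => fun pos psi =>
      success_prob iota A' pos (on_qubit v U *m psi)
  | Clifford2 v w U _ _ A' => fun pos psi =>
      success_prob iota A' pos (on_pair v w U *m psi)
  | Measure v A' => fun pos psi =>
      \sum_(b : bool) sqnorm (collapse v b psi) *
        success_prob iota (A' b) (fun w => pos (val w))
          (normalize (collapse v b psi))
  end.

(* Vertex names carry no information: the vertices of G are identified with some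
   of the qubits of |H> by an injection iota, chosen in advance.  This is needed
   since the swap of two qubits is itself a two-qubit Clifford operation. *)
Definition generated (t : nat) (H G : sgraph) : Prop :=
  exists iota : G -> H, injective iota /\
  exists A : algorithm H, (cz_complexity A <= t)%N /\
    forall psi : state H, graph_state psi -> success_prob iota A id psi = 1.

End Quantum.

(* Main.v *)
(* Up to phases and local Cliffords, a state is a set S of Paulis (those having
   it as an eigenvector), and a graph describes it in a frame: two anticommuting
   Paulis xi_v and zeta_v at each qubit v such that every xi_v zeta_{N(v)} is in
   S.  A local complementation only changes the frame, so it can be used to
   bring prescribed Paulis P_v to zeta_v, except at vertices where xi_v = P_v and
   no neighbour is exceptional.  For P the frame of another graph describing S
   there is no exception, because S is commutative, and then the graphs agree
   (Van den Nest, Dehaene, De Moor).  A two-qubit Clifford is an optional swap,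
   an optional controlled gate C(P_v, Q_w) and local Cliffords; when P_v and Q_w
   belong to the frame, and are not xi_v, xi_w with v and w adjacent, C(P_v, Q_w)
   keeps the frame and changes the graph by an elementary edge-complementation.
   Measuring Z_v = zeta_v deletes v.  Conversely every graph operation is realised
   by these gates up to a change of frame, undone by Hadamard and phase gates,
   and up to signs, undone by Z gates. *)
Require Import Defs.
From mathcomp Require Import all_boot all_order all_algebra.
From mathcomp Require Import reals complex.
From mathcomp Require Import perm spectral boolp ring.
From Stdlib Require Import Btauto.

Set Implicit Arguments.
Unset Strict Implicit.
Unset Printing Implicit Defensive.
Import Order.TTheory GRing.Theory Num.Theory.

(** * Elementary edge-complementations *)

Lemma adj_edge_compl (G : sgraph) (F : {set {set G}}) (x y : G) :
  @adj (edge_compl F) x y = adj x y (+) ((x != y) && ([set x; y] \in F)).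
Proof. by []. Qed.

Lemma eq_set2 (T : finType) (x y v w : T) : x != y ->
  ([set x; y] == [set v; w]) = (x == v) && (y == w) || (x == w) && (y == v).
Proof.
move=> xy; apply/eqP/idP => [E|]; last first.
  by case/orP => /andP[/eqP-> /eqP->] //; rewrite setUC.
have: x \in [set v; w] by rewrite -E set21.
have: y \in [set v; w] by rewrite -E set22.
have: v \in [set x; y] by rewrite E set21.
have: w \in [set x; y] by rewrite E set22.
rewrite !inE; do 4 (case/orP => /eqP ?); subst; rewrite ?eqxx ?orbT //=;
  by rewrite eqxx in xy.
Qed.

Lemma adj_local_compl (G : sgraph) (v x y : G) :
  @adj (local_compl v) x y = adj x y (+) [&& x != y, adj v x & adj v y].
Proof.
rewrite adj_edge_compl inE; congr (_ (+) _); case: eqVneq => //= xy.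
by rewrite cards2 xy subUset !sub1set !inE andbT.
Qed.

(** In a frame, these are the vertices whose generator anticommutes at [v] with [xi v] (for [a]
    true) or with [zeta v] (for [a] false); [framed_gate] rests on this. *)
Definition part (G : sgraph) (a : bool) (v : G) : G -> bool :=
  if a then adj v else pred1 v.

(* With [p] and [q] neighbourhoods or singletons, the elementary
   edge-complementations are the maps toggling {x, y} iff [p x q y + q x p y = 1]
   over the field with two elements. *)
Definition toggles (G : sgraph) (p q : G -> bool) (F : {set {set G}}) :=
  forall x y : G, x != y -> ([set x; y] \in F) = (p x && q y) (+) (q x && p y).

Lemma toggles_edge (G : sgraph) (v w : G) : v != w ->
  toggles (pred1 v) (pred1 w) [set [set v; w]].
Proof.
move=> vw x y xy; rewrite inE eq_set2 //=.
case: (x =P v) => [->|_] //=; case: (y =P w) => [->|_] //=.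
by rewrite (negPf vw).
Qed.

Lemma toggles_star (G : sgraph) (v w : G) : v != w ->
  toggles (pred1 v) (adj w) [set [set v; x] | x in nbh w :\ v].
Proof.
move=> vw x y xy /=; apply/imsetP/idP => [[u]|].
  rewrite !inE => /andP[/negPf uv wu] /eqP; rewrite eq_set2 //.
  case/orP => /andP[/eqP-> /eqP->]; rewrite eqxx wu uv ?andbF //.
case: (x =P v) => [Ex|_] /=; case: (y =P v) => [Ey|nyv] /=.
- by rewrite Ex Ey eqxx in xy.
- rewrite andbF addbF => wy; exists y; rewrite ?Ex // !inE wy andbT.
  exact/eqP.
- rewrite andbT => wx; exists x; last by rewrite Ey setUC.
  by rewrite !inE wx andbT -Ey.
- by rewrite andbF.
Qed.

Lemma toggles_bip (G : sgraph) (v w : G) :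
  toggles (adj v) (adj w) [set e : {set G} | [&& #|e| == 2%N,
      [exists x in nbh v, exists y in nbh w, e == [set x; y]]
      & ~~ (e \subset nbh v :&: nbh w)]].
Proof.
move=> x y xy; rewrite inE cards2 xy /= subUset !sub1set !inE.
have -> : [exists x0 in nbh v, exists y0 in nbh w, [set x; y] == [set x0; y0]]
   = adj v x && adj w y || adj w x && adj v y.
  apply/existsP/idP => [[a /andP[]]|/orP[]/andP[va wb]].
  - rewrite inE => va /existsP[b /andP[]]; rewrite inE => wb.
    rewrite eq_set2 // => /orP[]/andP[/eqP-> /eqP->]; rewrite va wb ?orbT //.
  - exists x; rewrite inE va; apply/existsP; exists y; rewrite inE wb /=.
    exact: eqxx.
  - exists y; rewrite inE wb; apply/existsP; exists x; rewrite inE va /=.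
    by rewrite setUC eqxx.
by case: (adj v x); case: (adj v y); case: (adj w x); case: (adj w y).
Qed.

Lemma elementary_toggles (G : sgraph) (F : {set {set G}}) : elementary_set F ->
  exists v w a b, [/\ v != w, ~~ [&& a, b & adj v w] &
    toggles (part a v) (part b w) F].
Proof.
case=> v w vw; last move=> nvw; exists v, w.
- by exists false, false; split => //; exact: toggles_edge.
- by exists false, true; split => //; exact: toggles_star.
- by exists true, true; split => //; exact: toggles_bip.
Qed.

(** The values of [a] and [b] give (i), (ii) in its two orientations, and (iii), whose non-adjacency
    condition is the second hypothesis. *)
Lemma toggles_elementary (G : sgraph) (v w : G) (a b : bool) :
  v != w -> ~~ [&& a, b & adj v w] ->
  exists F, elementary_set F /\ toggles (part a v) (part b w) F.
Proof.
case: a b => [] [] vw nvw.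
- by eexists; split; [exact: (ElemBip vw nvw)|exact: toggles_bip].
- rewrite eq_sym in vw; eexists; split; first exact: (ElemStar vw).
  by move=> x y xy; rewrite addbC; exact: toggles_star.
- by eexists; split; [exact: (ElemStar vw)|exact: toggles_star].
- by eexists; split; [exact: (ElemEdge vw)|exact: toggles_edge].
Qed.

Lemma graph_iso_trans (G H K : sgraph) :
  graph_iso G H -> graph_iso H K -> graph_iso G K.
Proof.
move=> [f bf Ef] [g bg Eg]; exists (g \o f); first exact: bij_comp.
by move=> x y /=; rewrite Eg Ef.
Qed.

Lemma graph_iso_del (G H : sgraph) (f : G -> H) (v : G) : bijective f ->
  (forall x y, adj (f x) (f y) = adj x y) ->
  graph_iso (vertex_del v) (vertex_del (f v)).
Proof.
case=> g fK gK Ef.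
have Pf (x : vertex_del v) : f (val x) != f v.
  by rewrite (inj_eq (can_inj fK)) (valP x).
have Pg (y : vertex_del (f v)) : g (val y) != v.
  apply: contraNneq (valP y) => E; apply/eqP.
  by rewrite -(gK (val y)) E.
exists (fun x => Sub (f (val x)) (Pf x) : vertex_del (f v)).
  exists (fun y => Sub (g (val y)) (Pg y) : vertex_del v) => x; apply: val_inj;
    by rewrite /= ?fK ?gK.
by move=> x y; rewrite /= /del_adj /= Ef.
Qed.

Lemma graph_iso_local (G H : sgraph) (f : G -> H) (v : G) : bijective f ->
  (forall x y, adj (f x) (f y) = adj x y) ->
  graph_iso (local_compl v) (local_compl (f v)).
Proof.
move=> bf Ef; exists f => // x y.
by rewrite !adj_local_compl !Ef (inj_eq (bij_inj bf)).
Qed.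

(** Each operation is transported along the isomorphism. An elementary one is transported through
    its parameters [v], [w], [a], [b] rather than through the family [F] itself. *)
Lemma obtained_iso k (H H' K : sgraph) :
  graph_iso H' H -> obtained k H K -> obtained k H' K.
Proof.
move=> HH' HK; elim: HK H' HH' => {k H K}.
- by move=> H G HG H' HH'; apply: ObtIso; exact: graph_iso_trans HG.
- move=> k H G v _ IH H' [f bf Ef]; have [g fK gK] := bf.
  apply: (@ObtDel _ _ _ (g v)); apply: IH.
  by rewrite -{2}(gK v); exact: graph_iso_del.
- move=> k H G v _ IH H' [f bf Ef]; have [g fK gK] := bf.
  apply: (@ObtLC _ _ _ (g v)); apply: IH.
  by rewrite -{2}(gK v); exact: graph_iso_local.
- move=> k H G F /elementary_toggles[v [w [a [b [vw nvw FE]]]]] _ IH H' [f bf Ef].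
  have [g fK gK] := bf; have fI := bij_inj bf.
  have partE c u x : part c (g u) x = part c u (f x).
    by case: c; rewrite /part -{2}(gK u) ?Ef //= (inj_eq fI).
  have [||F' [elF' FE']] := @toggles_elementary H' (g v) (g w) a b.
  - by rewrite (inj_eq (can_inj gK)).
  - by rewrite -Ef !gK.
  apply: (ObtElem elF'); apply: IH; exists f => // x y.
  rewrite !adj_edge_compl Ef (inj_eq fI); congr (_ (+) _).
  by case: eqVneq => //= xy; rewrite FE' // FE ?(inj_eq fI) // !partE.
Qed.

(** * Paulis up to phase and frames of a graph *)

(** [(x, z)] stands for X^x Z^z up to phase: [paddb] is then the product, and [omega] tells whether
    two Paulis anticommute. *)
Definition pauli_bits : Type := bool * bool.

Definition bI : pauli_bits := (false, false).
Definition bX : pauli_bits := (true, false).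
Definition bZ : pauli_bits := (false, true).

Definition paddb (p q : pauli_bits) : pauli_bits := (p.1 (+) q.1, p.2 (+) q.2).
Definition pscale (b : bool) (p : pauli_bits) : pauli_bits :=
  (b && p.1, b && p.2).
Definition omega (p q : pauli_bits) : bool := (p.1 && q.2) (+) (q.1 && p.2).

Local Notation "p +b q" := (paddb p q) (at level 50, left associativity).
Local Notation "b *b q" := (pscale b q) (at level 40).

Lemma omegaC p q : omega p q = omega q p.
Proof. by rewrite /omega addbC. Qed.

Lemma omegapp p : omega p p = false.
Proof. exact: addbb. Qed.

Lemma omegaDl p q r : omega (p +b q) r = omega p r (+) omega q r.
Proof. by case: p q r => [[] []] [[] []] [[] []]. Qed.

Lemma omegaZl b p q : omega (b *b p) q = b && omega p q.
Proof. by case: b p q => [] [[] []] [[] []]. Qed.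

Lemma omegaDr p q r : omega r (p +b q) = omega r p (+) omega r q.
Proof. by rewrite omegaC omegaDl !(omegaC r). Qed.

Lemma omegaZr b p q : omega p (b *b q) = b && omega p q.
Proof. by rewrite omegaC omegaZl omegaC. Qed.

Lemma omega1_cases (p q r : pauli_bits) : omega p q -> r != bI ->
  [\/ r = p, r = q | r = p +b q].
Proof.
case: p q r => [[] []] [[] []] [[] []] // _ _;
  by [constructor 1|constructor 2|constructor 3].
Qed.

Lemma addb_xorb b c : b (+) c = xorb b c.
Proof. by case: b c => [] []. Qed.

Ltac bool_ring :=
  rewrite /paddb /pscale /=;
  repeat match goal with
  | |- context [@fst bool bool ?p] => case: p => [? ?] /=
  | |- context [@snd bool bool ?p] => case: p => [? ?] /=
  end;
  rewrite ?addb_xorb; first [done | btauto | congr pair; btauto].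

Section Frames.
Variable V : finType.
Implicit Types (e : rel V) (h g : V -> pauli_bits) (S : (V -> pauli_bits) -> Prop).
Implicit Types xi zeta : V -> pauli_bits.

Definition vaddb h g : V -> pauli_bits := fun x => h x +b g x.

Definition vomega h g : bool := \big[addb/false]_v omega (h v) (g v).

Definition generator e xi zeta (u : V) : V -> pauli_bits :=
  fun x => if x == u then xi x else e u x *b zeta x.

Definition add_closed S := forall h g, S h -> S g -> S (vaddb h g).

Definition isotropic S := forall h g, S h -> S g -> vomega h g = false.

Definition framed S e xi zeta :=
  (forall v, omega (xi v) (zeta v)) /\ (forall u, S (generator e xi zeta u)).

(** Passing from [H] to [H'] is free: the count [k] is the same on both sides. *)
Definition lc_refines (H H' : sgraph) :=
  forall k K, obtained k H' K -> obtained k H K.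

Lemma lc_refines_trans H1 H2 H3 :
  lc_refines H1 H2 -> lc_refines H2 H3 -> lc_refines H1 H3.
Proof. by move=> r12 r23 k K /r23/r12. Qed.

(** With [xi], [zeta] in the roles of X, Z, [lc_xi] and [lc_zeta] describe the local Clifford of a
    local complementation: a square root of X at [v] and a square root of Z at its neighbours. *)
Definition lc_xi e v xi zeta : V -> pauli_bits :=
  fun x => xi x +b e v x *b zeta x.
Definition lc_zeta v xi zeta : V -> pauli_bits :=
  fun x => zeta x +b (x == v) *b xi x.

(** The new generator of [u] is the old one, multiplied by the generator of [v] if [u] is adjacent
    to [v]; so it stays in [S]. *)
Lemma framed_local S e (es : symmetric e) (ei : irreflexive e) v xi zeta :
  add_closed S -> framed S e xi zeta ->
  framed S (@adj (@local_compl (SGraph es ei) v)) (lc_xi e v xi zeta)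
    (lc_zeta v xi zeta).
Proof.
move=> SD [om_xz SK]; split=> [x|u].
  rewrite /lc_xi /lc_zeta omegaDl !omegaDr !omegaZl !omegaZr !omegapp om_xz.
  by rewrite omegaC om_xz; case: (x =P v) => [->|_]; rewrite ?ei ?andbF.
suff <- : vaddb (generator e xi zeta u)
    (fun x => e v u *b generator e xi zeta v x) =
    generator (@adj (@local_compl (SGraph es ei) v)) (lc_xi e v xi zeta)
      (lc_zeta v xi zeta) u.
  case: (e v u).
    have -> : (fun x => true *b generator e xi zeta v x) = generator e xi zeta v.
      by apply: funext => x; rewrite /pscale; case: generator.
    exact: SD.
  rewrite (_ : vaddb _ _ = generator e xi zeta u) //.
  by apply: funext => x; rewrite /vaddb /paddb /= !addbF; case: generator.
apply: funext => x; rewrite /vaddb /generator adj_local_compl /lc_xi /lc_zeta /=.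
rewrite (eq_sym x u) (eq_sym x v); move: (ei u) (ei v) (es u v).
case: (eqVneq u x) => [->|ux] /=; case: (eqVneq x v) => [->|xv] /= Eu Ev E;
  rewrite ?Eu ?Ev ?E /=; bool_ring.
Qed.

Lemma add_scaled S h g (b : bool) : add_closed S -> S h -> (b -> S g) ->
  S (vaddb h (fun x => b *b g x)).
Proof.
move=> SD Sh; case: b => [/(_ isT) Sg|_].
  rewrite (_ : (fun x => true *b g x) = g); first exact: SD.
  by apply: funext => x; rewrite /pscale; case: (g x).
rewrite (_ : vaddb _ _ = h) //.
by apply: funext => x; rewrite /vaddb; bool_ring.
Qed.

(* The symplectic action of the controlled gate
   (1 + P_v + Q_w - P_v Q_w) / 2, a controlled-Z up to local Cliffords. *)
Definition cgate (v w : V) (P Q : pauli_bits) h : V -> pauli_bits := fun x =>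
  h x +b ((x == v) && omega (h w) Q) *b P +b ((x == w) && omega (h v) P) *b Q.

(** Let K_u be the generator of [u]. The gate multiplies K_u by P_v if [q u] and by Q_w if [p u].
    When [P] is [xi v], the gate fixes K_v, and multiplying by K_v as well replaces xi_v by the
    zetas on the neighbourhood of [v]; likewise at [w]. In all cases [zeta x] is added with
    coefficient [(p x && q u) (+) (q x && p u)]. *)
Lemma framed_gate S S' e (es : symmetric e) (ei : irreflexive e) e' xi zeta
    (v w : V) (a b : bool) :
  add_closed S' -> framed S e xi zeta ->
  v != w -> ~~ [&& a, b & e v w] ->
  let p := part a (v : SGraph es ei) in
  let q := part b (w : SGraph es ei) in
  (forall x y, x != y -> e' x y = e x y (+) ((p x && q y) (+) (q x && p y))) ->
  (forall h, S h -> S' (cgate v w (if a then xi v else zeta v)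
                                  (if b then xi w else zeta w) h)) ->
  framed S' e' xi zeta.
Proof.
set P := if a then xi v else _; set Q := if b then xi w else _.
move=> SD [om_xz SK] vw nvw p q e'E SS'; split=> // u.
have omP c y z : omega (generator e xi zeta y z) (if c then xi z else zeta z) =
    part c (z : SGraph es ei) y.
  rewrite /generator /part eq_sym; case: eqVneq => [->|yz]; case: c;
    rewrite ?omegaZl ?omegapp ?om_xz ?andbF ?ei //= ?eqxx //.
    by rewrite omegaC om_xz andbT es.
  by rewrite (negPf yz).
have SC y := SS' _ (SK y).
have pp : a -> p v = false by rewrite /p /part => -> /=; rewrite ei.
have qq : b -> q w = false by rewrite /q /part => -> /=; rewrite ei.
(* Here and in [pw] the non-adjacency of [v] and [w] enters when [a] and [b] both hold; these facts
   make K_v (for [a]) and K_w (for [b]) invariant under the gate. *)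
have qv : a -> q v = false.
  by rewrite /q /part; case: (b) nvw => + ta; rewrite ta /= ?(negPf vw) // es => /negPf.
have pw : b -> p w = false.
  move=> tb; rewrite /p /part; case: (a) nvw; rewrite tb /= ?[w == v]eq_sym ?(negPf vw) //.
  by move=> /negPf.
have Kv : a -> S' (generator e xi zeta v).
  move=> ta; suff <- : cgate v w P Q (generator e xi zeta v) = generator e xi zeta v.
    exact: SC.
  by apply: funext => x; rewrite /cgate !omP -/p -/q pp // qv //; bool_ring.
have Kw : b -> S' (generator e xi zeta w).
  move=> tb; suff <- : cgate v w P Q (generator e xi zeta w) = generator e xi zeta w.
    exact: SC.
  by apply: funext => x; rewrite /cgate !omP -/p -/q pw // qq //; bool_ring.
have := add_scaled SD (add_scaled SD (SC u) (b := a && q u)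
  (fun t => Kv (proj1 (andP t)))) (b := b && p u) (fun t => Kw (proj1 (andP t))).
congr S'; apply: funext => x; rewrite /vaddb /cgate !omP -/(p u) -/(q u).
have PE : (x == v) *b P +b a *b generator e xi zeta v x = p x *b zeta x.
  rewrite /P /p /part /generator; case: (a) => /=; case: (eqVneq x v) => [->|xv];
  by rewrite ?ei; bool_ring.
have QE : (x == w) *b Q +b b *b generator e xi zeta w x = q x *b zeta x.
  rewrite /Q /q /part /generator; case: (b) => /=; case: (eqVneq x w) => [->|xw];
  by rewrite ?ei; bool_ring.
transitivity (generator e xi zeta u x +b
  ((p x && q u) (+) (q x && p u)) *b zeta x).
  transitivity (generator e xi zeta u x +b
     (q u *b (p x *b zeta x) +b p u *b (q x *b zeta x))); last by bool_ring.
  by rewrite -PE -QE; move: (generator _ _ _ u x) (generator _ _ _ v x)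
    (generator _ _ _ w x) => *; bool_ring.
(* At [x = u] the coefficient is [p u && q u] added to itself, so the Pauli there stays [xi u]. *)
rewrite /generator; case: eqVneq => [->|xu].
  bool_ring.
rewrite e'E 1?eq_sym //; bool_ring.
Qed.

Lemma lc_refines_local (H : sgraph) (v : H) : lc_refines H (local_compl v).
Proof. by move=> k K; exact: ObtLC. Qed.

Lemma lc_step S e (es : symmetric e) (ei : irreflexive e) xi zeta (v : V) :
  add_closed S -> framed S e xi zeta ->
  exists e' (es' : symmetric e') (ei' : irreflexive e'),
  [/\ lc_refines (SGraph es ei) (SGraph es' ei'),
    framed S e' (lc_xi e v xi zeta) (lc_zeta v xi zeta) & e' v =1 e v].
Proof.
move=> SD fr; exists (@adj (@local_compl (SGraph es ei) v)).
exists (@adj_sym (@local_compl (SGraph es ei) v)).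
exists (@adj_irr (@local_compl (SGraph es ei) v)); split.
- exact: (@lc_refines_local (SGraph es ei)).
- exact: framed_local.
- by move=> x; rewrite adj_local_compl /= ei andbF addbF.
Qed.

(* Each round removes one vertex v from the set of those v in [B] with
   [zeta v != P v]: a local complementation at v when P v = xi v + zeta v, and a
   pivot on an edge {v, w} inside that set when P = xi at both ends. *)
Lemma lc_normalise S e (es : symmetric e) (ei : irreflexive e) xi zeta
    (B : {set V}) (P : V -> pauli_bits) :
  add_closed S -> framed S e xi zeta -> {in B, forall v, P v != bI} ->
  exists e' (es' : symmetric e') (ei' : irreflexive e') xi' zeta',
  [/\ lc_refines (SGraph es ei) (SGraph es' ei'), framed S e' xi' zeta' &
    {in B, forall v, zeta' v != P v ->
      xi' v = P v /\ {in B, forall w, e' v w -> zeta' w = P w}}].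
Proof.
move=> SD + P0; pose bad z := [set v in B | z v != P v].
have [n] := ubnP #|bad zeta|; elim: n => // n IH in e es ei xi zeta *.
move=> badn fr.
have descend e1 (es1 : symmetric e1) (ei1 : irreflexive e1) xi1 zeta1 v :
    lc_refines (SGraph es ei) (SGraph es1 ei1) -> framed S e1 xi1 zeta1 ->
    bad zeta1 \subset bad zeta -> v \in bad zeta -> zeta1 v = P v ->
    exists e' (es' : symmetric e') (ei' : irreflexive e') xi' zeta',
    [/\ lc_refines (SGraph es ei) (SGraph es' ei'), framed S e' xi' zeta' &
    {in B, forall v, zeta' v != P v ->
      xi' v = P v /\ {in B, forall w, e' v w -> zeta' w = P w}}].
  move=> r1 fr1 sub1 vbad z1.
  have [|e' [es' [ei' [xi' [zeta' [r fr' H]]]]]] := IH _ es1 ei1 _ _ _ fr1.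
    rewrite -ltnS; apply: leq_trans badn; apply: proper_card.
    by apply/properP; split=> //; exists v => //; rewrite inE z1 eqxx andbF.
  exists e', es', ei', xi', zeta'; split=> //.
  exact: lc_refines_trans r1 r.
have third v : v \in B -> zeta v != P v -> P v != xi v -> P v = xi v +b zeta v.
  move=> vB Pz Px; case: (omega1_cases (fr.1 v) (P0 v vB)) => // E.
    by rewrite E eqxx in Px.
  by rewrite E eqxx in Pz.
have subbad e1 xi1 v : v \in bad zeta -> bad (lc_zeta v xi1 zeta) \subset bad zeta.
  move=> vbad; apply/subsetP => x; rewrite inE /lc_zeta.
  case: (eqVneq x v) => [->|xv] //; rewrite inE; congr (_ && (_ != _)).
  by bool_ring.
have [/existsP[v /andP[vbad Pxi]]|nbad] := boolP [exists v in bad zeta, P v != xi v].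
  have [e1 [es1 [ei1 [r1 fr1 _]]]] := lc_step es ei v SD fr.
  apply: (descend _ es1 ei1 _ _ v r1 fr1 _ vbad).
    exact: subbad.
  move: vbad; rewrite inE => /andP[vB vz]; rewrite (third v) // /lc_zeta eqxx.
  by bool_ring.
have xiP v : v \in bad zeta -> xi v = P v.
  move=> vbad; apply/esym/eqP; apply: contraNT nbad => H.
  by apply/existsP; exists v; rewrite vbad.
have [/existsP[v /andP[vbad /existsP[w /andP[wbad vw]]]]|npiv] :=
    boolP [exists v in bad zeta, exists w in bad zeta, e v w].
  (* The complementation at [w] turns [xi v] into xi_v + zeta_v, and the one at [v] then turns
     [zeta v] into zeta_v + xi_v + zeta_v = xi_v = P_v. Among the zetas only those at [v] and [w]
     change, and [w] was already bad. *)
  have [e1 [es1 [ei1 [r1 fr1 e1E]]]] := lc_step es ei w SD fr.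
  have [e2 [es2 [ei2 [r2 fr2 _]]]] := lc_step es1 ei1 v SD fr1.
  have wv : (v == w) = false by apply: contraTF vw => /eqP ->; rewrite ei.
  apply: (descend _ es2 ei2 _ _ v _ fr2 _ vbad).
  - exact: lc_refines_trans r1 r2.
  - apply/subsetP => x; rewrite inE /lc_zeta.
    case: (eqVneq x v) => [->|xv] //; case: (eqVneq x w) => [->|xw] //.
    rewrite inE; congr (_ && (_ != _)); by bool_ring.
  - rewrite /lc_zeta /lc_xi eqxx wv es vw -(xiP v vbad); by bool_ring.
exists e, es, ei, xi, zeta; split=> // v vB vz.
have vbad : v \in bad zeta by rewrite inE vB.
split=> [|w wB vw]; first exact: xiP.
apply/eqP; apply: contraNT npiv => wz; apply/existsP; exists v; rewrite vbad.
by apply/existsP; exists w; rewrite inE wB wz.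
Qed.

Lemma vomega_split (A : {set V}) h g :
  (forall x, x \notin A -> omega (h x) (g x) = false) ->
  vomega h g = \big[addb/false]_(x in A) omega (h x) (g x).
Proof.
move=> H; rewrite /vomega (bigID (mem A)) /= [X in _ (+) X]big1 ?addbF //.
Qed.

(* The theorem of Van den Nest, Dehaene and De Moor. *)
Lemma framed_same_refines S e (es : symmetric e) (ei : irreflexive e) xi zeta
    e' (es' : symmetric e') (ei' : irreflexive e') xi' zeta' :
  add_closed S -> isotropic S -> framed S e xi zeta -> framed S e' xi' zeta' ->
  lc_refines (SGraph es ei) (SGraph es' ei').
Proof.
move=> SD SI fr fr'.
have [|e1 [es1 [ei1 [xi1 [zeta1 [r fr1 H]]]]]] :=
    @lc_normalise S e es ei xi zeta setT zeta' SD fr.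
  move=> v _; apply: contraTneq (fr'.1 v) => ->.
  by case: (xi' v) => [[] []].
apply: lc_refines_trans r _.
have zz v : zeta1 v = zeta' v.
  (* At an exceptional [v] the two generators of [v] anticommute at [v], where they are [zeta' v]
     and [xi' v]. They commute elsewhere, since [zeta1] equals [zeta'] on the neighbours of [v].
     This contradicts isotropy. *)
  apply/eqP/idPn => vz; have [xv nb] := H v (in_setT v) vz.
  have := SI _ _ (fr1.2 v) (fr'.2 v); rewrite (@vomega_split [set v]).
    by rewrite big_set1 /generator eqxx xv omegaC fr'.1.
  move=> x; rewrite inE => /negPf xv'; rewrite /generator xv' omegaZl omegaZr.
  case: (boolP (e1 v x)) => //= vx.
  by rewrite nb // omegapp andbF.
(* Now that the zetas agree, the first generator of [x] and the second generator of [y] can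
   anticommute only at [x], which contributes [e' x y], and at [y], which contributes [e1 x y]. *)
have ee x y : e' x y = e1 x y.
  have [->|xy] := eqVneq x y; first by rewrite ei' ei1.
  have := SI _ _ (fr1.2 x) (fr'.2 y); rewrite (@vomega_split [set x; y]).
    rewrite big_setU1 ?inE // big_set1 /generator !eqxx (negPf xy).
    rewrite eq_sym (negPf xy) omegaZl omegaZr zz -(zz x) fr1.1 omegaC fr'.1 es'.
    by rewrite !andbT; case: (e' x y); case: (e1 x y).
  move=> u; rewrite !inE negb_or => /andP[/negPf ux /negPf uy].
  by rewrite /generator ux uy omegaZl omegaZr zz omegapp !andbF.
move=> k K; apply: obtained_iso; exists id => //; by exists id.
Qed.
End Frames.

(** * Symplectic maps of one and two qubits *)

Definition local_map (X Z p : pauli_bits) : pauli_bits := p.1 *b X +b p.2 *b Z.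

Lemma omega_local_map X Z p q : omega X Z ->
  omega (local_map X Z p) (local_map X Z q) = omega p q.
Proof. by case: X Z p q => [[] []] [[] []] [[] []] [[] []]. Qed.

Lemma local_map_id p : local_map bX bZ p = p.
Proof. by case: p => [[] []]. Qed.

Lemma local_mapD X Z p q : local_map X Z (p +b q) = local_map X Z p +b local_map X Z q.
Proof. by rewrite /local_map; bool_ring. Qed.

Definition pair_omega (a b : pauli_bits * pauli_bits) : bool :=
  omega a.1 b.1 (+) omega a.2 b.2.

(* Every symplectic map of two qubits has this form. *)
Definition pair_map (sw : bool) (X1 Z1 X2 Z2 P Q p1 p2 : pauli_bits) :
    pauli_bits * pauli_bits :=
  let r1 := if sw then p2 else p1 in
  let r2 := if sw then p1 else p2 in
  (local_map X1 Z1 (r1 +b omega r2 Q *b P), local_map X2 Z2 (r2 +b omega r1 P *b Q)).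

(** Quantification over the sixteen two-qubit Paulis as an explicit conjunction, so that [pair_mapP]
    can be decided by evaluation. *)
Definition all_pairs (f : pauli_bits * pauli_bits -> bool) : bool :=
  let all_bits g := [&& g bI, g bX, g bZ & g (true, true)] in
  all_bits (fun p => all_bits (fun q => f (p, q))).

Lemma all_pairsP f : all_pairs f -> forall a, f a.
Proof.
move=> H; have allb g : [&& g bI, g bX, g bZ & g (true, true)] ->
    forall p : pauli_bits, g p.
  by case/and4P => ? ? ? ? [[] []].
by case=> p q; exact: (allb _ (allb _ H p) q).
Qed.

(* The block of [pair_map] from the first qubit to itself has determinant
   [~~ sw]; once the swap is undone the diagonal blocks are the local maps, and
   [P], [Q] are read off the block from the second qubit to the first. *)
Lemma pair_mapP (a1 a2 a3 a4 : pauli_bits * pauli_bits) :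
  pair_omega a1 a2 -> ~~ pair_omega a1 a3 -> ~~ pair_omega a2 a3 ->
  ~~ pair_omega a1 a4 -> ~~ pair_omega a2 a4 -> pair_omega a3 a4 ->
  exists sw X1 Z1 X2 Z2 P Q, let M := pair_map sw X1 Z1 X2 Z2 P Q in
    [/\ omega X1 Z1, omega X2 Z2 & [/\ M bX bI = a1, M bZ bI = a2,
        M bI bX = a3 & M bI bZ = a4]].
Proof.
pose check a1 a2 a3 a4 :=
  let sw := ~~ omega a1.1 a2.1 in
  let b1 := if sw then a3 else a1 in let b2 := if sw then a4 else a2 in
  let b3 := if sw then a1 else a3 in let b4 := if sw then a2 else a4 in
  let P' := if b3.1 == bI then b4.1 else b3.1 in
  let P := (omega P' b2.1, omega b1.1 P') in
  let Q := (b4.1 != bI, b3.1 != bI) in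
  let M := pair_map sw b1.1 b2.1 b3.2 b4.2 P Q in
  [&& omega b1.1 b2.1, omega b3.2 b4.2, M bX bI == a1, M bZ bI == a2,
      M bI bX == a3 & M bI bZ == a4].
have H : all_pairs (fun a1 => all_pairs (fun a2 => pair_omega a1 a2 ==>
    all_pairs (fun a3 => ~~ pair_omega a1 a3 && ~~ pair_omega a2 a3 ==>
    all_pairs (fun a4 => [&& ~~ pair_omega a1 a4, ~~ pair_omega a2 a4
      & pair_omega a3 a4] ==> check a1 a2 a3 a4)))).
  by vm_compute.
move=> h12 h13 h23 h14 h24 h34.
have := all_pairsP (implyP (all_pairsP (all_pairsP H a1) a2) h12) a3.
rewrite h13 h23 => /implyP/(_ isT)/all_pairsP /(_ a4); rewrite h14 h24 h34 /= /check.
case/and5P=> o1 o2 /eqP e1 /eqP e2 /andP[/eqP e3 /eqP e4].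
do 7 eexists; split; [exact: o1|exact: o2|].
by split; [exact: e1|exact: e2|exact: e3|exact: e4].
Qed.

(** * Frames after gates, measurements and relabellings *)

Section FrameExistence.
Variable V : finType.
Implicit Types (e : rel V) (S : (V -> pauli_bits) -> Prop).
Implicit Types xi zeta : V -> pauli_bits.

(** [lc_normalise] on [[set v; w]] makes [P] and [Q] members of the frame and excludes that both are
    xi at adjacent vertices, so [framed_gate] applies. If [P] or [Q] is the identity, the gate acts
    trivially and costs nothing, whence an inequality for [k']. *)
Lemma gate_frame S S' e (es : symmetric e) (ei : irreflexive e) xi zeta
    (v w : V) (P Q : pauli_bits) :
  add_closed S -> add_closed S' -> framed S e xi zeta -> v != w ->
  (forall h, S h -> S' (cgate v w P Q h)) ->
  exists e' (es' : symmetric e') (ei' : irreflexive e') xi' zeta',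
    framed S' e' xi' zeta' /\
    forall k K, obtained k (SGraph es' ei') K ->
      exists2 k', (k' <= k.+1)%N & obtained k' (SGraph es ei) K.
Proof.
move=> SD SD' fr vw SS'.
have [PQ|PQ] := boolP ((P == bI) || (Q == bI)).
  exists e, es, ei, xi, zeta; split; last by move=> k K; exists k.
  case: fr => om_xz SK; split=> // u.
  suff <- : cgate v w P Q (generator e xi zeta u) = generator e xi zeta u.
    exact: SS'.
  apply: funext => x; rewrite /cgate /omega.
  by case/orP: PQ => /eqP ->; bool_ring.
move: PQ; rewrite negb_or => /andP[P0 Q0].
have [|e1 [es1 [ei1 [xi1 [zeta1 [r fr1 H]]]]]] := @lc_normalise _ S e es ei xi zeta
    [set v; w] (fun x => if x == v then P else Q) SD fr.
  by move=> x _; case: ifP.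
have wv : (w == v) = false by rewrite eq_sym (negPf vw).
have := H v (set21 _ _); have := H w (set22 _ _); rewrite eqxx wv => {H} Hw Hv.
pose a := zeta1 v != P; pose b := zeta1 w != Q.
have nvw : ~~ [&& a, b & e1 v w].
  apply/and3P => -[av bw e1vw]; have [_ /(_ w (set22 _ _) e1vw)] := Hv av.
  by rewrite wv => E; rewrite /b E eqxx in bw.
have PE : P = if a then xi1 v else zeta1 v.
  by rewrite /a; case: eqVneq => [->|/Hv[]].
have QE : Q = if b then xi1 w else zeta1 w.
  by rewrite /b; case: eqVneq => [->|/Hw[]].
have [F [elF FE]] := @toggles_elementary (SGraph es1 ei1) v w a b vw nvw.
exists (@adj (edge_compl F)), (@adj_sym (edge_compl F)), (@adj_irr (edge_compl F)).
exists xi1, zeta1; split.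
  apply: (framed_gate (es := es1) (ei := ei1) SD' fr1 vw nvw) => [x y xy|h Sh].
    by rewrite adj_edge_compl xy FE.
  by rewrite -PE -QE; exact: SS'.
move=> k K ob; exists k.+1 => //; apply: r; apply: (ObtElem elF).
exact: ob.
Qed.

(** After normalisation at [v], the case left is [xi v = P]. Complementing at a neighbour and then
    at [v] brings [P] to zeta_v. Without a neighbour, no generator of another vertex acts on [v]. *)
Lemma measure_frame S e (es : symmetric e) (ei : irreflexive e) xi zeta
    (v : V) (P : pauli_bits) :
  add_closed S -> framed S e xi zeta -> P != bI ->
  exists e' (es' : symmetric e') (ei' : irreflexive e') xi' zeta',
  [/\ lc_refines (SGraph es ei) (SGraph es' ei'), framed S e' xi' zeta' &
    zeta' v = P \/ forall u, e' u v = false].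
Proof.
move=> SD fr P0.
have [|e1 [es1 [ei1 [xi1 [zeta1 [r fr1 H]]]]]] := @lc_normalise _ S e es ei xi zeta
    [set v] (fun=> P) SD fr.
  by [].
have [zv|zv] := eqVneq (zeta1 v) P.
  by exists e1, es1, ei1, xi1, zeta1; split=> //; left.
have [xv _] := H v (set11 v) zv.
have [/existsP[u uv]|nu] := boolP [exists u, e1 u v]; last first.
  exists e1, es1, ei1, xi1, zeta1; split=> //; right=> u.
  by apply: contraNF nu => uv; apply/existsP; exists u.
have [e2 [es2 [ei2 [r2 fr2 _]]]] := lc_step es1 ei1 u SD fr1.
have [e3 [es3 [ei3 [r3 fr3 _]]]] := lc_step es2 ei2 v SD fr2.
have vu : (v == u) = false by apply: contraTF uv => /eqP ->; rewrite ei1.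
do 5 eexists; split; [|exact: fr3|].
  exact: (lc_refines_trans r (lc_refines_trans r2 r3)).
by left; rewrite /lc_zeta /lc_xi eqxx vu uv -xv; bool_ring.
Qed.

(** The generators of the other vertices carry the identity or [P] at [v], hence survive the
    measurement; restricted to the other vertices they are the generators of the smaller graph. *)
Lemma framed_del S (v : V) (S' : ({x : V | x != v} -> pauli_bits) -> Prop) e
    (es : symmetric e) (ei : irreflexive e) xi zeta P :
  framed S e xi zeta ->
  (forall h, S h -> h v = bI \/ h v = P -> S' (h \o val)) ->
  zeta v = P \/ (forall u, e u v = false) ->
  framed S' (@adj (@vertex_del (SGraph es ei) v)) (xi \o val) (zeta \o val).
Proof.
move=> [om_xz SK] SS' zv; split=> [x|u]; first exact: om_xz.
rewrite (_ : generator _ _ _ _ = generator e xi zeta (val u) \o val) //.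
apply: SS' => //; rewrite /generator [v == _]eq_sym (negPf (valP u)).
case: zv => [->|->]; last by left; rewrite /pscale.
by case: (e _ v); [right|left]; rewrite /pscale //; case: P.
Qed.

Lemma framed_local_map S S' e xi zeta (X Z : V -> pauli_bits) :
  (forall x, omega (X x) (Z x)) -> framed S e xi zeta ->
  (forall h, S h -> S' (fun x => local_map (X x) (Z x) (h x))) ->
  let f z := fun x : V => local_map (X x) (Z x) (z x) in
  framed S' e (f xi) (f zeta).
Proof.
move=> XZ [om_xz SK] SS' f; split=> [x|u]; first by rewrite /f omega_local_map.
rewrite -[generator _ _ _ _](_ : (fun x =>
  local_map (X x) (Z x) (generator e xi zeta u x)) = _); first exact: SS'.
apply: funext => x; rewrite /f /generator /local_map.
by case: (x == u) => //; bool_ring.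
Qed.

Lemma framed_perm S S' e xi zeta (s : V -> V) : injective s -> framed S e xi zeta ->
  (forall h, S h -> S' (h \o s)) ->
  framed S' (fun x y => e (s x) (s y)) (xi \o s) (zeta \o s).
Proof.
move=> sI [om_xz SK] SS'; split=> [x|u]; first exact: om_xz.
rewrite -[generator _ _ _ _](_ : generator e xi zeta (s u) \o s = _).
  exact: SS'.
by apply: funext => x; rewrite /generator /= (inj_eq sI).
Qed.
End FrameExistence.

(** * Pauli operators acting on states *)

Local Open Scope ring_scope.
Local Open Scope sesquilinear_scope.

Section Amplitudes.
Variables (C : numClosedFieldType) (V : finType).
Implicit Types (psi : state C V) (x y : bits V).

Lemma amp_mk (f : bits V -> C) x : amp (mk_state f) x = f x.
Proof. by rewrite /amp mxE enum_rankK. Qed.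

Lemma state_ext psi phi : amp psi =1 amp phi -> psi = phi.
Proof.
move=> E; apply/matrixP => i j; rewrite ord1 -(enum_valK i).
exact: E.
Qed.

Lemma entry_mk (f : bits V -> bits V -> C) x y : entry (mk_oper f) x y = f x y.
Proof. by rewrite /entry mxE !enum_rankK. Qed.

Lemma amp_mul (A : oper C V) psi x :
  amp (A *m psi) x = \sum_y entry A x y * amp psi y.
Proof.
rewrite /amp mxE (reindex enum_rank) //=.
by exists enum_val => i _; rewrite ?enum_rankK ?enum_valK.
Qed.

Lemma ampZ c psi x : amp (c *: psi) x = c * amp psi x.
Proof. by rewrite /amp mxE. Qed.

Lemma sqnormE psi : sqnorm psi = \sum_x `|amp psi x| ^+ 2.
Proof.
rewrite /sqnorm (reindex enum_rank) //=.
by exists enum_val => i _; rewrite ?enum_rankK ?enum_valK.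
Qed.

Lemma sqnormZ c psi : sqnorm (c *: psi) = `|c| ^+ 2 * sqnorm psi.
Proof.
rewrite !sqnormE mulr_sumr; apply: eq_bigr => x _.
by rewrite ampZ normrM exprMn.
Qed.

Lemma sqnorm_ge0 psi : 0 <= sqnorm psi.
Proof. by apply: sumr_ge0 => i _; rewrite exprn_ge0. Qed.

Lemma sqnorm0 : sqnorm (0 : state C V) = 0.
Proof. by rewrite /sqnorm big1 // => i _; rewrite mxE normr0 expr0n. Qed.

Lemma sqnorm_normalize psi : sqnorm psi != 0 -> sqnorm (normalize psi) = 1.
Proof.
move=> psi0; rewrite sqnormZ normfV.
rewrite ger0_norm ?sqrtC_ge0 ?sqnorm_ge0 // exprVn sqrtCK mulVf //.
Qed.
End Amplitudes.

Section Weyl.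
Variables (C : numClosedFieldType) (V : finType).
Implicit Types (psi : state C V) (x y : bits V) (h g : V -> pauli_bits).

Definition flip h x : bits V := [ffun v => x v (+) (h v).1].

Definition wsign h x : C := \prod_v (-1) ^+ ((h v).2 && x v).

(* The Pauli operator of [h] up to a phase, with bits (x, z) standing for X^x Z^z. *)
Definition weyl h psi : state C V :=
  mk_state (fun x => wsign h x * amp psi (flip h x)).

Lemma amp_weyl h psi x : amp (weyl h psi) x = wsign h x * amp psi (flip h x).
Proof. exact: amp_mk. Qed.

Lemma weylZ c h psi : weyl h (c *: psi) = c *: weyl h psi.
Proof.
by apply: state_ext => x; rewrite ampZ !amp_weyl ampZ mulrCA.
Qed.

Lemma weyl0 psi : weyl (fun=> bI) psi = psi.
Proof.
apply: state_ext => x; rewrite amp_weyl /wsign big1 // mul1r; congr amp.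
by apply/ffunP => v; rewrite ffunE addbF.
Qed.

Lemma weyl_weyl h g psi :
  weyl h (weyl g psi) =
    (\prod_v (-1) ^+ ((g v).2 && (h v).1)) *: weyl (vaddb h g) psi.
Proof.
apply: state_ext => x; rewrite ampZ !amp_weyl !mulrA; congr (_ * _); last first.
  by congr amp; apply/ffunP => v; rewrite !ffunE /= addbA.
rewrite /wsign -!big_split; apply: eq_bigr => v _ /=.
rewrite ffunE -!signr_addb; congr (_ ^+ nat_of_bool _).
by case: (g v) (h v) (x v) => [[] []] [[] []] [].
Qed.

Lemma sign_vomega h g :
  (-1) ^+ vomega h g = \prod_v (-1) ^+ omega (h v) (g v) :> C.
Proof.
by rewrite /vomega (big_morph (fun b : bool => (-1) ^+ b : C) (@signr_addb C)
  (expr0 _ : (-1) ^+ false = 1 :> C)).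
Qed.

Lemma weyl_comm h g psi :
  weyl h (weyl g psi) = (-1) ^+ vomega h g *: weyl g (weyl h psi).
Proof.
rewrite !weyl_weyl scalerA sign_vomega -big_split /=.
have -> : vaddb h g = vaddb g h by apply: funext => v; rewrite /vaddb; bool_ring.
congr (_ *: _); apply: eq_bigr => v _; rewrite -signr_addb; congr (_ ^+ nat_of_bool _).
by case: (g v) (h v) => [[] []] [[] []].
Qed.

(** The eigenvalue [a] is common to all states of [Psi], so that one choice of sign corrections
    serves the whole class. A single state is the class [eq psi]. *)
Definition stab (Psi : state C V -> Prop) h : Prop :=
  exists a : C, forall psi, Psi psi -> weyl h psi = a *: psi.

Lemma stab_add Psi : add_closed (stab Psi).
Proof.
move=> h g [a Ha] [b Hb].
exists ((\prod_v (-1) ^+ ((g v).2 && (h v).1))^-1 * (a * b)) => psi Ppsi.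
have := weyl_weyl h g psi; rewrite (Hb _ Ppsi) weylZ (Ha _ Ppsi) scalerA => E.
rewrite -scalerA mulrC E scalerA mulVf ?scale1r //.
by apply/prodf_neq0 => v _; rewrite signr_eq0.
Qed.

Lemma weyl_neq0 h psi : psi != 0 -> weyl h psi != 0.
Proof.
apply: contraNneq => E; have := weyl_weyl h h psi.
rewrite E (_ : vaddb h h = fun=> bI); last first.
  by apply: funext => v; rewrite /vaddb /paddb !addbb.
have -> : weyl h (0 : state C V) = 0.
  by have := weylZ 0 h (0 : state C V); rewrite !scale0r.
rewrite weyl0 => /esym/eqP.
rewrite scaler_eq0 => /orP[|/eqP //]; rewrite prodf_seq_eq0.
by move=> /hasP[v _]; rewrite /= signr_eq0.
Qed.

(** Anticommuting operators with a common eigenvector would have eigenvalues with ab = -ab, but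
    Paulis are invertible, so both are nonzero. *)
Lemma stab_isotropic (Psi : state C V -> Prop) psi :
  Psi psi -> psi != 0 -> isotropic (stab Psi).
Proof.
move=> Ppsi psi0 h g [a Ha] [b Hb].
have nz k c : weyl k psi = c *: psi -> c != 0.
  move=> E; apply: contraTneq (weyl_neq0 k psi0) => c0.
  by rewrite E c0 scale0r eqxx.
have a0 := nz _ _ (Ha _ Ppsi); have b0 := nz _ _ (Hb _ Ppsi).
have := weyl_comm h g psi; rewrite (Hb _ Ppsi) (Ha _ Ppsi) !weylZ.
rewrite (Hb _ Ppsi) (Ha _ Ppsi) !scalerA => E.
have {E}: (b * a - (-1) ^+ vomega h g * a * b) *: psi = 0.
  by apply/eqP; rewrite scalerBl subr_eq0 E !mulrA.
move/eqP; rewrite scaler_eq0 (negPf psi0) orbF; case: vomega => //.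
rewrite expr1 mulN1r mulNr opprK mulrC -mulr2n -mulr_natr !mulf_eq0.
by rewrite (negPf a0) (negPf b0) pnatr_eq0.
Qed.
End Weyl.

Definition pauli_to_bits (p : pauli) : pauli_bits :=
  match p with
  | PI => (false, false) | PX => (true, false)
  | PY => (true, true) | PZ => (false, true)
  end.

Definition bits_to_pauli (p : pauli_bits) : pauli :=
  match p with
  | (false, false) => PI | (true, false) => PX
  | (true, true) => PY | (false, true) => PZ
  end.

Lemma bits_to_pauliK : cancel bits_to_pauli pauli_to_bits.
Proof. by case=> [[] []]. Qed.

Lemma pauli_to_bitsK : cancel pauli_to_bits bits_to_pauli.
Proof. by case. Qed.

(** * Pauli tensors and their phases *)

Section PauliTensor.
Variables (C : numClosedFieldType) (V : finType).
Implicit Types (psi : state C V) (h : V -> pauli).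

(** [weyl] applies X before Z, and Y = -i ZX. *)
Definition pauli_phase h : C := \prod_v (if h v is PY then - 'i else 1).

Lemma pauli_tensorE h psi : pauli_tensor C h *m psi =
  pauli_phase h *: weyl (fun v => pauli_to_bits (h v)) psi.
Proof.
set k := fun v => pauli_to_bits _; apply: state_ext => x; rewrite ampZ amp_weyl amp_mul.
rewrite (bigD1 (flip k x)) //= big1 ?addr0 => [|y yx].
  rewrite entry_mk mulrA -big_split; congr (_ * _); apply: eq_bigr => v _ /=.
  rewrite ffunE /k; case: (h v) => /=; rewrite ?addbT ?addbF ?eqxx ?mul1r //.
  - by case: (x v).
  - by case: (x v); rewrite /= ?expr1 ?mulrN1 ?opprK ?mulr1.
have [v yv] : exists v, y v != flip k x v.
  apply/existsP; apply: contraNT yx; rewrite negb_exists => /forallP H.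
  by apply/eqP/ffunP => v; apply/eqP; rewrite -[_ == _]negbK.
rewrite entry_mk (bigD1 v) //= [pauli_mx _ _ _ _](_ : _ = 0) ?mul0r //.
move: yv; rewrite ffunE /k.
by case: (h v); case: (x v); case: (y v).
Qed.

Lemma pauli_phase_neq0 h : pauli_phase h != 0.
Proof.
apply/prodf_neq0 => v _; case: (h v); rewrite ?oner_eq0 // oppr_eq0.
exact: neq0Ci.
Qed.

Lemma pauli_phase4 h : pauli_phase h ^+ 4 = 1.
Proof.
rewrite -prodrXl big1 // => v _; case: (h v); rewrite ?expr1n //.
by rewrite (exprM _ 2 2) sqrrN sqrCi sqrrN expr1n.
Qed.

Lemma mem_phase (a : C) : (a \in [:: 1; -1; 'i; - 'i]) = (a ^+ 4 == 1).
Proof.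
rewrite !inE -[RHS]subr_eq0.
have -> : a ^+ 4 - 1 = (a - 1) * ((a + 1) * ((a - 'i) * (a + 'i))).
  have -> : (a - 'i) * (a + 'i) = a ^+ 2 + 1.
    by rewrite -subr_sqr sqrCi opprK.
  by ring.
by rewrite !mulf_eq0 !subr_eq0 !addr_eq0.
Qed.
End PauliTensor.

Lemma graph_stabilizerE (C : numClosedFieldType) (G : sgraph) (v : G)
    (psi : state C G) :
  graph_stabilizer C v *m psi = weyl (generator (@adj G) (fun=> bX) (fun=> bZ) v) psi.
Proof.
rewrite /graph_stabilizer pauli_tensorE /pauli_phase big1 ?scale1r => [|w _].
  congr weyl; apply: funext => w; rewrite /generator.
  by case: eqP => //; case: adj.
by case: eqP => //; case: adj.
Qed.

(** * Operations on a few qubits *)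

Section Slices.
Variables (C : numClosedFieldType) (V : finType) (k : nat) (q : 'I_k -> V).
Hypothesis q_inj : injective q.
Implicit Types (psi : state C V) (x y : bits V) (z : bits 'I_k).

Definition overwrite x z : bits V :=
  [ffun w => if [pick i | q i == w] is Some i then z i else x w].

Definition restr x : bits 'I_k := [ffun i => x (q i)].

Lemma overwrite_in x z i : overwrite x z (q i) = z i.
Proof.
rewrite ffunE; case: pickP => [j /eqP/q_inj -> //|/(_ i)].
by rewrite eqxx.
Qed.

Lemma overwrite_out x z v : v \notin codom q -> overwrite x z v = x v.
Proof.
move=> vq; rewrite ffunE; case: pickP => // j /eqP E.
by rewrite -E codom_f in vq.
Qed.

Lemma overwriteK x z : restr (overwrite x z) = z.
Proof. by apply/ffunP => i; rewrite ffunE overwrite_in. Qed.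

Lemma overwrite_eq x x' z :
  (forall v, v \notin codom q -> x v = x' v) -> overwrite x z = overwrite x' z.
Proof.
move=> E; apply/ffunP => v; have [/codomP[i ->]|vq] := boolP (v \in codom q).
  by rewrite !overwrite_in.
by rewrite !overwrite_out // E.
Qed.

Lemma overwrite_restr x y :
  (forall v, v \notin codom q -> x v = y v) -> overwrite x (restr y) = y.
Proof.
move=> E; apply/ffunP => v; have [/codomP[i ->]|vq] := boolP (v \in codom q).
  by rewrite overwrite_in ffunE.
by rewrite overwrite_out // E.
Qed.

(** The unnormalized state of the [k] qubits once the bits outside the range of [q] are fixed as in
    [x]; [on_qubits q U] acts as [U] on each slice. *)
Definition slice x psi : state C 'I_k := mk_state (fun z => amp psi (overwrite x z)).

Lemma amp_slice x psi z : amp (slice x psi) z = amp psi (overwrite x z).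
Proof. exact: amp_mk. Qed.

Lemma slice_eq x x' psi :
  (forall v, v \notin codom q -> x v = x' v) -> slice x psi = slice x' psi.
Proof.
by move=> E; apply: state_ext => z; rewrite !amp_slice (overwrite_eq _ E).
Qed.

Lemma amp_on_qubits (U : oper C 'I_k) psi x :
  amp (on_qubits q U *m psi) x = amp (U *m slice x psi) (restr x).
Proof.
rewrite !amp_mul.
under eq_bigr => y _ do rewrite entry_mk mulrC (fun_if ( *%R _)) mulr0.
rewrite -big_mkcond (reindex_onto (overwrite x) restr) /=; last first.
  move=> y /forallP H; apply: overwrite_restr => v vq.
  by apply/eqP; move: (H v); rewrite vq.
apply: eq_big => [z|z _].
  rewrite overwriteK eqxx andbT; apply/forallP => v; apply/implyP => vq.
  by rewrite overwrite_out.
by rewrite mulrC amp_slice; congr (entry _ _ _ * _); exact: overwriteK.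
Qed.

Lemma prod_codom (F : V -> C) :
  \prod_v F v = \prod_(v | v \notin codom q) F v * \prod_i F (q i).
Proof.
rewrite (bigID (mem (codom q))) /= mulrC; congr (_ * _).
rewrite -(big_uniq (codom q)) ?big_image //.
by rewrite map_inj_uniq ?enum_uniq.
Qed.

Lemma slice_weyl x h psi : slice x (weyl h psi) =
  (\prod_(v | v \notin codom q) (-1) ^+ ((h v).2 && x v)) *:
    weyl (h \o q) (slice (flip h x) psi).
Proof.
apply: state_ext => z; rewrite ampZ amp_slice !amp_weyl amp_slice mulrA.
congr (_ * _); last congr amp.
  rewrite /wsign prod_codom; congr (_ * _).
    by apply: eq_bigr => v vq; rewrite overwrite_out.
  by apply: eq_bigr => i _; rewrite overwrite_in.
apply/ffunP => v; rewrite ffunE.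
have [/codomP[i ->]|vq] := boolP (v \in codom q).
  by rewrite !overwrite_in ffunE.
by rewrite !overwrite_out // ffunE.
Qed.

(** Conjugation by [U] takes [g] to [g'] up to a scalar, written without the inverse of [U]. *)
Definition intertwines (U : oper C 'I_k) (g g' : 'I_k -> pauli_bits) : Prop :=
  exists2 a : C, a != 0 & forall phi, U *m weyl g phi = a *: weyl g' (U *m phi).

Lemma on_qubits_weyl (U : oper C 'I_k) (h h' : V -> pauli_bits) a psi :
  (forall phi, U *m weyl (h \o q) phi = a *: weyl (h' \o q) (U *m phi)) ->
  (forall v, v \notin codom q -> h' v = h v) ->
  on_qubits q U *m weyl h psi = a *: weyl h' (on_qubits q U *m psi).
Proof.
move=> HU out; apply: state_ext => x.
rewrite ampZ amp_weyl !amp_on_qubits slice_weyl -scalemxAr ampZ HU ampZ amp_weyl.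
rewrite mulrCA; congr (_ * _); rewrite mulrA /wsign prod_codom; congr (_ * _ * _).
- by apply: eq_bigr => v vq; rewrite out.
- by apply: eq_bigr => i _; rewrite ffunE.
- rewrite (@slice_eq (flip h' x) (flip h x)); last first.
    by move=> v vq; rewrite !ffunE out.
  by congr amp; apply/ffunP => i; rewrite !ffunE.
Qed.

Lemma stab_on_qubits (U : oper C 'I_k) Psi Phi (h h' : V -> pauli_bits) :
  intertwines U (h \o q) (h' \o q) ->
  (forall v, v \notin codom q -> h' v = h v) ->
  (forall phi, Phi phi -> exists2 psi, Psi psi & phi = on_qubits q U *m psi) ->
  stab Psi h -> stab Phi h'.
Proof.
move=> [a a0 HU] out PhiE [b Hb].
exists (a^-1 * b) => phi /PhiE[psi Ppsi ->].
have := on_qubits_weyl psi HU out; rewrite Hb // -scalemxAr => E.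
by rewrite -scalerA E scalerA mulVf // scale1r.
Qed.

(** Exchanging [z] with the bits of [x] on the range of [q] is an involution on the pairs of [x] and
    [z]. *)
Lemma sum_overwrite (F : bits V -> C) :
  \sum_x \sum_z F (overwrite x z) = #|{: bits 'I_k}|%:R * \sum_x F x.
Proof.
have -> : #|{: bits 'I_k}|%:R * \sum_x F x = \sum_x \sum_(z : bits 'I_k) F x.
  rewrite mulr_sumr; apply: eq_bigr => x _.
  by rewrite sumr_const mulr_natl.
rewrite !pair_big /= (reindex (fun p => (overwrite p.1 p.2, restr p.1))) /=.
  apply: eq_bigr => -[x z] _ /=; congr F.
  by apply: overwrite_restr => v; exact: overwrite_out.
have K : cancel (fun p : bits V * bits 'I_k => (overwrite p.1 p.2, restr p.1))
                (fun p => (overwrite p.1 p.2, restr p.1)).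
  move=> [x z] /=; rewrite overwriteK overwrite_restr // => v.
  exact: overwrite_out.
by exists (fun p => (overwrite p.1 p.2, restr p.1)) => p _; exact: K.
Qed.

Lemma sqnorm_unitary n (U : oper C 'I_n) (phi : state C 'I_n) :
  U \is unitarymx -> sqnorm (U *m phi) = sqnorm phi.
Proof.
have E (psi : state C 'I_n) : sqnorm psi = (psi^t* *m psi) 0 0.
  by rewrite mxE; apply: eq_bigr => i _; rewrite !mxE normCKC.
move=> /unitarymxP Uu; rewrite !E trmx_mul map_mxM mulmxA -[_ *m _ *m U]mulmxA.
by rewrite (mulmx1C Uu) mulmx1.
Qed.

(** Summing the squared norms of the slices over all [x] counts each amplitude equally often, and
    [U] preserves the norm of every slice. *)
Lemma sqnorm_on_qubits (U : oper C 'I_k) psi :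
  U \is unitarymx -> sqnorm (on_qubits q U *m psi) = sqnorm psi.
Proof.
move=> Uu; have k0 : #|{: bits 'I_k}|%:R != 0 :> C.
  rewrite pnatr_eq0 -lt0n; apply/card_gt0P; by exists [ffun=> false].
apply: (mulfI k0); rewrite !sqnormE -!sum_overwrite; apply: eq_bigr => x _.
transitivity (sqnorm (U *m slice x psi)).
  rewrite sqnormE; apply: eq_bigr => z _; rewrite amp_on_qubits overwriteK.
  by rewrite (@slice_eq _ x) // => v; exact: overwrite_out.
by rewrite sqnorm_unitary // sqnormE; apply: eq_bigr => z _; rewrite amp_slice.
Qed.
End Slices.

(** * The action of Clifford operations on Paulis *)

Section Intertwine.
Variables (C : numClosedFieldType) (k : nat).
Implicit Types (U : oper C 'I_k) (g : 'I_k -> pauli_bits).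

Lemma intertwines_add U g1 g1' g2 g2' :
  intertwines U g1 g1' -> intertwines U g2 g2' ->
  intertwines U (vaddb g1 g2) (vaddb g1' g2').
Proof.
move=> [a a0 Ha] [b b0 Hb].
set s := fun h g : 'I_k -> pauli_bits =>
  \prod_v (-1) ^+ ((g v).2 && (h v).1) : C.
have s0 h g : s h g != 0 by apply/prodf_neq0 => v _; rewrite signr_eq0.
exists ((s g1 g2)^-1 * (a * b * s g1' g2')) => [|phi].
  by rewrite !mulf_neq0 ?invr_eq0.
have : U *m weyl g1 (weyl g2 phi) = (a * b) *: weyl g1' (weyl g2' (U *m phi)).
  by rewrite Ha Hb weylZ scalerA.
rewrite !weyl_weyl -!/(s _ _) -scalemxAr scalerA => E.
by rewrite -scalerA -E scalerA mulVf // scale1r.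
Qed.

(** The commutation sign of [weyl_comm] survives conjugation; it is compared on one nonzero
    vector. *)
Lemma unitary_omega U g1 g1' g2 g2' : U \is unitarymx ->
  intertwines U g1 g1' -> intertwines U g2 g2' -> vomega g1' g2' = vomega g1 g2.
Proof.
move=> /unitarymxP Uu [a a0 Ha] [b b0 Hb].
pose phi : state C 'I_k := mk_state (fun=> 1).
have phi0 : phi != 0.
  apply/eqP => /(congr1 (fun p => amp p [ffun=> false])).
  by rewrite amp_mk /amp mxE; apply/eqP; rewrite oner_eq0.
have Uphi0 : U *m phi != 0.
  apply: contraNneq phi0 => E; have := mulmxA (U^t*) U phi.
  by rewrite E mulmx0 (mulmx1C Uu) mul1mx => <-.
have E1 : U *m weyl g1 (weyl g2 phi) = (a * b) *: weyl g1' (weyl g2' (U *m phi)).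
  by rewrite Ha Hb weylZ scalerA.
have E2 : U *m weyl g2 (weyl g1 phi) = (a * b) *: weyl g2' (weyl g1' (U *m phi)).
  by rewrite Hb Ha weylZ scalerA mulrC.
have ab0 : a * b != 0 by rewrite mulf_neq0.
move: E1; rewrite weyl_comm -scalemxAr E2 (weyl_comm g1') => /eqP.
rewrite !scalerA -subr_eq0 -scalerBl scaler_eq0 orbC.
rewrite (negPf (weyl_neq0 _ (weyl_neq0 _ Uphi0))) /= mulrC -mulrBr mulf_eq0.
rewrite (negPf ab0) /=; case: (vomega g1 g2); case: (vomega g1' g2') => //.
  by rewrite expr0 expr1 -opprD oppr_eq0 (pnatr_eq0 _ 2).
by rewrite expr0 expr1 opprK (pnatr_eq0 _ 2).
Qed.

Lemma clifford_intertwines U g : clifford_group U ->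
  exists g', intertwines U g g'.
Proof.
pose h i := bits_to_pauli (g i).
case=> Uu /(_ (U *m pauli_tensor C h *m U^t*)) [_ []].
  exists (pauli_tensor C h) => //; exists 1; first by rewrite mem_head.
  by exists h; rewrite scale1r.
move=> a; rewrite mem_phase => /eqP a4 [h' E]; exists (fun i => pauli_to_bits (h' i)).
have a0 : a != 0 by apply: contra_eq_neq a4 => ->; rewrite expr0n eq_sym oner_eq0.
exists ((pauli_phase C h)^-1 * (a * pauli_phase C h')) => [|phi].
  by rewrite !mulf_neq0 ?invr_eq0 ?pauli_phase_neq0.
have {}E : U *m (pauli_tensor C h *m phi) = a *: (pauli_tensor C h' *m (U *m phi)).
  by rewrite scalemxAl -E !mulmxA mulmxKtV.
rewrite !pauli_tensorE -scalemxAr scalerA in E.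
rewrite -scalerA -E scalerA mulVf ?pauli_phase_neq0 // scale1r.
congr (_ *m weyl _ _); apply: funext => i; by rewrite /h bits_to_pauliK.
Qed.
End Intertwine.

Section CliffordAction.
Variable C : numClosedFieldType.

Lemma intertwines0 k (U : oper C 'I_k) : intertwines U (fun=> bI) (fun=> bI).
Proof.
by exists 1; rewrite ?oner_eq0 // => phi; rewrite !weyl0 scale1r.
Qed.

Lemma intertwinesZ k (U : oper C 'I_k) g g' (b : bool) : intertwines U g g' ->
  intertwines U (fun i => b *b g i) (fun i => b *b g' i).
Proof.
have E (h : 'I_k -> pauli_bits) c : (fun i => c *b h i) = if c then h else fun=> bI.
  by apply: funext => i; case: c => //=; case: (h i).
by case: b => H; rewrite !E //; exact: intertwines0.
Qed.

Lemma clifford1_action (U : oper C 'I_1) : clifford_group U ->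
  exists X Z, omega X Z /\
    forall p, intertwines U (fun=> p) (fun=> local_map X Z p).
Proof.
move=> cU; have E (g : 'I_1 -> pauli_bits) : g = fun=> g ord0.
  by apply: funext => i; rewrite ord1.
have [X HX] := clifford_intertwines (fun=> bX) cU.
have [Z HZ] := clifford_intertwines (fun=> bZ) cU.
exists (X ord0), (Z ord0); split.
  have := unitary_omega cU.1 HX HZ.
  by rewrite /vomega !big_ord_recl !big_ord0 !addbF.
move=> p; rewrite -[fun _ => p](_ : vaddb (fun=> p.1 *b bX) (fun=> p.2 *b bZ) = _).
  rewrite (E X) in HX; rewrite (E Z) in HZ.
  exact: intertwines_add (intertwinesZ _ HX) (intertwinesZ _ HZ).
by apply: funext => i; case: p => [[] []].
Qed.

Definition on_two (p q : pauli_bits) : 'I_2 -> pauli_bits :=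
  fun i => if i == ord0 then p else q.

(** The images of X and Z on each qubit satisfy the commutation relations required by [pair_mapP],
    and all other Paulis are sums of these four. *)
Lemma clifford2_action (U : oper C 'I_2) : clifford_group U ->
  exists sw X1 Z1 X2 Z2 P Q, let M := pair_map sw X1 Z1 X2 Z2 P Q in
  [/\ omega X1 Z1, omega X2 Z2 &
    forall p1 p2, intertwines U (on_two p1 p2) (on_two (M p1 p2).1 (M p1 p2).2)].
Proof.
move=> cU; have E (g : 'I_2 -> pauli_bits) : g = on_two (g ord0) (g ord_max).
  apply: funext => i; rewrite /on_two; case: eqP => [-> //|/eqP].
  by case: i => [[|[|]]] //= ? _; congr g; apply: val_inj.
have om p q p' q' : vomega (on_two p q) (on_two p' q') = pair_omega (p, q) (p', q').
  by rewrite /vomega !big_ord_recl big_ord0 addbF.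
have ex p q : exists a, intertwines U (on_two p q) (on_two a.1 a.2).
  have [g] := clifford_intertwines (on_two p q) cU; rewrite (E g).
  by exists (g ord0, g ord_max).
have [a1 H1] := ex bX bI; have [a2 H2] := ex bZ bI.
have [a3 H3] := ex bI bX; have [a4 H4] := ex bI bZ.
have uo p q p' q' a b : intertwines U (on_two p q) (on_two a.1 a.2) ->
    intertwines U (on_two p' q') (on_two b.1 b.2) ->
    pair_omega a b = pair_omega (p, q) (p', q').
  move=> Ha Hb; have := unitary_omega cU.1 Ha Hb.
  by rewrite !om; case: a b {Ha Hb} => ? ? [].
have [||||||sw [X1 [Z1 [X2 [Z2 [P [Q [o1 o2 [M1 M2 M3 M4]]]]]]]]] :=
    @pair_mapP a1 a2 a3 a4.
- by rewrite (uo _ _ _ _ _ _ H1 H2).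
- by rewrite (uo _ _ _ _ _ _ H1 H3).
- by rewrite (uo _ _ _ _ _ _ H2 H3).
- by rewrite (uo _ _ _ _ _ _ H1 H4).
- by rewrite (uo _ _ _ _ _ _ H2 H4).
- by rewrite (uo _ _ _ _ _ _ H3 H4).
exists sw, X1, Z1, X2, Z2, P, Q; split=> // p1 p2.
rewrite -M1 in H1; rewrite -M2 in H2; rewrite -M3 in H3; rewrite -M4 in H4.
have := intertwines_add (intertwines_add (intertwinesZ p1.1 H1) (intertwinesZ p1.2 H2))
  (intertwines_add (intertwinesZ p2.1 H3) (intertwinesZ p2.2 H4)).
congr intertwines; apply: funext => i; rewrite /vaddb /on_two; case: (i == ord0).
- by case: p1 p2 => [[] []] [[] []].
- by case: p1 p2 => [[] []] [[] []].
- clear; rewrite /pair_map /local_map /omega /=; case: sw; bool_ring.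
- clear; rewrite /pair_map /local_map /omega /=; case: sw; bool_ring.
Qed.
End CliffordAction.

(** * Renaming and measuring qubits *)

Section Registers.
Variable C : numClosedFieldType.

Lemma amp_rename (V W : finType) (f : V -> W) (psi : state C V) x :
  amp (rename f psi) x = amp psi [ffun v => x (f v)].
Proof. exact: amp_mk. Qed.

Lemma rename_weyl (V W : finType) (f : V -> W) (h : W -> pauli_bits) (psi : state C V) :
  bijective f -> rename f (weyl (h \o f) psi) = weyl h (rename f psi).
Proof.
move=> bf; apply: state_ext => x.
rewrite amp_rename !amp_weyl amp_rename; congr (_ * _); last first.
  by congr amp; apply/ffunP => v; rewrite !ffunE.
rewrite /wsign [RHS](reindex f) /=; last exact: onW_bij.
by apply: eq_bigr => v _; rewrite ffunE.
Qed.

Lemma rename_inj (V W : finType) (f : V -> W) :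
  bijective f -> injective (rename f : state C V -> state C W).
Proof.
move=> [g fK gK] psi phi E; apply: state_ext => x.
have := congr1 (fun p => amp p [ffun w => x (g w)]) E; rewrite !amp_rename.
rewrite (_ : [ffun v => _] = x) //.
by apply/ffunP => v; rewrite !ffunE fK.
Qed.

Lemma sqnorm_rename (V W : finType) (f : V -> W) (psi : state C V) :
  bijective f -> sqnorm (rename f psi) = sqnorm psi.
Proof.
move=> [g fK gK]; rewrite !sqnormE.
rewrite [RHS](reindex (fun x : bits W => [ffun v => x (f v)])) /=.
  by apply: eq_bigr => x _; rewrite amp_rename.
exists (fun y : bits V => [ffun w => y (g w)]) => x _;
  by apply/ffunP => v; rewrite !ffunE ?fK ?gK.
Qed.

(** A Pauli that is I or Z at [v] is diagonal there, so outcome [b] turns this factor into a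
    sign. *)
Lemma collapse_weyl (V : finType) (v : V) b h (psi : state C V) :
  (h v).1 = false -> collapse v b (weyl h psi) =
    (-1) ^+ ((h v).2 && b) *: weyl (h \o val) (collapse v b psi).
Proof.
move=> hv; apply: state_ext => x; rewrite ampZ amp_weyl !amp_mk mulrA.
have ext_v y : @extend_bits V v b y v = b by rewrite ffunE insubF ?eqxx.
have ext_w y w : @extend_bits V v b y (val w) = y w by rewrite ffunE valK.
congr (_ * _); last first.
  congr amp; apply/ffunP => w; rewrite [LHS]ffunE.
  have [->|wv] := eqVneq w v; first by rewrite !ext_v hv addbF.
  by rewrite -[w]/(val (exist (fun w => w != v) w wv)) !ext_w ffunE.
rewrite /wsign (bigD1 v) //= ext_v; congr (_ * _).
rewrite (reindex_omap (val : {w | w != v} -> V) insub) /=; last first.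
  by move=> w wv; rewrite insubT.
apply: eq_big => [w|w _]; last by rewrite ext_w.
by rewrite (valP w) valK eqxx.
Qed.

Lemma sqnorm_collapse (V : finType) (v : V) (psi : state C V) :
  \sum_(b : bool) sqnorm (collapse v b psi) = sqnorm psi.
Proof.
rewrite [RHS]sqnormE.
under eq_bigr => b _ do rewrite sqnormE.
rewrite pair_big /=.
rewrite [RHS](reindex (fun p : bool * bits {w | w != v} =>
  extend_bits p.1 p.2)) /=.
  by apply: eq_bigr => -[b x] _; rewrite amp_mk.
exists (fun y : bits V => (y v, [ffun w : {w | w != v} => y (val w)])).
  move=> [b x] _ /=; congr (_, _); first by rewrite ffunE insubF ?eqxx.
  by apply/ffunP => w; rewrite !ffunE valK.
move=> y _; apply/ffunP => w; rewrite ffunE /=.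
by case: insubP => [u _ <-|]; rewrite ?ffunE // negbK => /eqP ->.
Qed.
End Registers.

Lemma pair_inj (V : finType) (v w : V) : v != w ->
  injective (fun i : 'I_2 => if i == ord0 then v else w).
Proof.
by move=> vw [[|[|//]] ?] [[|[|//]] ?] /= E; apply: val_inj; rewrite //=;
  move: E vw => ->; rewrite eqxx.
Qed.

(** * From algorithms to graph operations *)

Section Forward.
Variables (C : numClosedFieldType) (L : finType) (G : sgraph) (iota : G -> L).

Lemma framed_graph_state (H : sgraph) (psi : state C H) : graph_state psi ->
  framed (stab (eq psi)) (@adj H) (fun=> bX) (fun=> bZ).
Proof.
move=> [_ gs]; split=> // u; exists 1 => _ <-.
by rewrite -graph_stabilizerE scale1r.
Qed.

(** The frame X, Z of [G], pulled back along [f], and the given frame describe the same state, so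
    [framed_same_refines] relates the two graphs. *)
Lemma output_obtained (V : finType) e (es : symmetric e) (ei : irreflexive e)
    xi zeta (pos : V -> L) (psi : state C V) :
  framed (stab (eq psi)) e xi zeta -> is_output iota pos psi ->
  obtained 0 (SGraph es ei) G.
Proof.
move=> fr [f [bf _ gs]]; pose e' x y := adj (f x) (f y).
have es' : symmetric e' by move=> x y; rewrite /e' adj_sym.
have ei' : irreflexive e' by move=> x; rewrite /e' adj_irr.
have psi0 : psi != 0.
  apply: contra_eq_neq gs.1 => ->; rewrite sqnorm_rename // sqnorm0.
  by rewrite eq_sym oner_eq0.
have fr' : framed (stab (eq psi)) e' (fun=> bX) (fun=> bZ).
  split=> // u; exists 1 => _ <-; apply: (rename_inj bf); rewrite scale1r.
  have := gs.2 (f u); rewrite graph_stabilizerE -rename_weyl //.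
  congr (rename f (weyl _ _) = _); apply: funext => x.
  by rewrite /generator /= (inj_eq (bij_inj bf)).
apply: (@framed_same_refines _ _ _ es ei _ _ _ es' ei' _ _ (@stab_add _ _ _)
  (stab_isotropic (erefl psi) psi0) fr fr').
by apply: ObtIso; exists f.
Qed.

Lemma stab_measure (V : finType) (v : V) b (Psi : state C V -> Prop) Phi h :
  (forall phi, Phi phi -> exists2 psi, Psi psi & phi = normalize (collapse v b psi)) ->
  stab Psi h -> h v = bI \/ h v = bZ -> stab Phi (h \o val).
Proof.
move=> PhiE [a Ha] hv; have hv1 : (h v).1 = false by case: hv => ->.
exists ((-1) ^+ ((h v).2 && b) * a) => _ /PhiE[psi Ppsi ->].
have := collapse_weyl b psi hv1; rewrite (Ha _ Ppsi) => E.
rewrite /normalize weylZ scalerA mulrC -scalerA -scalerA; congr (_ *: _).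
have collapseZ c (phi : state C V) : collapse v b (c *: phi) = c *: collapse v b phi.
  by apply: state_ext => x; rewrite ampZ !amp_mk ampZ.
by rewrite -collapseZ E scalerA -signr_addb addbb scale1r.
Qed.

(** Asking only for nonzero success probability lets the induction follow a single outcome of each
    measurement; the maximum in [cz_complexity] bounds the gates on that branch. *)
Lemma success_obtained (V : finType) (A : algorithm C V) e (es : symmetric e)
    (ei : irreflexive e) xi zeta (pos : V -> L) (psi : state C V) :
  framed (stab (eq psi)) e xi zeta -> success_prob iota A pos psi != 0 ->
  exists2 k, (k <= cz_complexity A)%N & obtained k (SGraph es ei) G.
Proof.
elim: A e es ei xi zeta pos psi => {V}
  [V|V v U cU A IH|V v w U vw cU A IH|V v A IH] e es ei xi zeta pos psi fr /=.
- case: asboolP => [out _|_]; last by rewrite eqxx.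
  by exists 0%N => //; exact: output_obtained fr out.
- have [X [Z [XZ HU]]] := clifford1_action cU.
  apply: (IH _ es ei); apply: (@framed_local_map _ _ _ _ _ _
    (fun x => if x == v then X else bX) (fun x => if x == v then Z else bZ) _ fr).
    by move=> x; case: ifP.
  move=> h; apply: (@stab_on_qubits _ _ _ (fun _ : 'I_1 => v) _ U (eq psi)).
  + by move=> i j _; rewrite (ord1 i) (ord1 j).
  + have := HU (h v); congr (intertwines _ _ _).
    by apply: funext => i /=; rewrite eqxx.
  + move=> x xv; case: eqP => [E|_]; last by rewrite local_map_id.
    by rewrite E (codom_f (fun _ : 'I_1 => v) ord0) in xv.
  + by move=> _ <-; exists psi.
- have [sw [X1 [Z1 [X2 [Z2 [P [Q [o1 o2 HU]]]]]]]] := clifford2_action cU.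
  set S' := stab (eq (on_pair v w U *m psi)).
  (* The optional swap is moved into a relabelling of the initial stabilizer ([S1]) and the local
     Cliffords into the final one ([S2]); only a [cgate] remains between them. The relabelled graph
     is isomorphic to the original, so the swap is free. *)
  pose s x := if sw then tperm v w x else x.
  pose X x := if x == v then X1 else if x == w then X2 else bX.
  pose Z x := if x == v then Z1 else if x == w then Z2 else bZ.
  pose S1 h := stab (eq psi) (h \o s).
  pose S2 h := S' (fun x => local_map (X x) (Z x) (h x)).
  have ss : involutive s by rewrite /s; case: (sw) => x; rewrite ?tpermK.
  have eE x y : e (s (s x)) (s (s y)) = e x y by rewrite !ss.
  pose e1 x y := e (s x) (s y).
  have es1 : symmetric e1 by move=> x y; exact: es.
  have ei1 : irreflexive e1 by move=> x; exact: ei.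
  have fr1 : framed S1 e1 (xi \o s) (zeta \o s).
    apply: framed_perm fr _; first exact: inv_inj.
    move=> h; rewrite /S1 (_ : (h \o s) \o s = h) //.
    by apply: funext => x /=; rewrite ss.
  have D1 : add_closed S1 by move=> h g; exact: stab_add.
  have D2 : add_closed S2.
    move=> h g Sh Sg; have := stab_add Sh Sg; congr S'.
    by apply: funext => x; rewrite /vaddb local_mapD.
  have [|e2 [es2 [ei2 [xi2 [zeta2 [fr2 H]]]]]] :=
      gate_frame (S' := S2) es1 ei1 (P := P) (Q := Q) D1 D2 fr1 vw.
    pose q (i : 'I_2) := if i == ord0 then v else w.
    move=> h; apply: (@stab_on_qubits _ _ _ q _ U (eq psi)).
    + exact: pair_inj.
    + have := HU (h (s v)) (h (s w)).
      congr (intertwines _ _ _); apply: funext => i; rewrite /on_two /q /=.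
        by case: ifP.
      have wv : (w == v) = false by rewrite eq_sym (negPf vw).
      have hs : (if sw then h (s w) else h (s v)) = h v /\
                (if sw then h (s v) else h (s w)) = h w.
        by rewrite /s; case: (sw); rewrite ?tpermL ?tpermR.
      rewrite /pair_map hs.1 hs.2 /cgate /X /Z /=.
      by case: ifP => _; rewrite ?eqxx ?wv ?(negPf vw) /=; congr local_map;
        bool_ring.
    + move=> x xvw; have [xv xw] : (x == v) = false /\ (x == w) = false.
        split; apply: contraNF xvw => /eqP ->; apply/codomP.
          by exists ord0.
        by exists ord_max.
      rewrite /= /X /Z /cgate xv xw local_map_id /s.
      case: (sw); rewrite ?tpermD 1?eq_sym ?xv ?xw //; bool_ring.
    + by move=> _ <-; exists psi.
  have om_XZ x : omega (X x) (Z x).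
    by rewrite /X /Z; case: ifP => // _; case: ifP.
  move=> succ; have [k kA ob] := IH _ es2 ei2 _ _ _ _
    (@framed_local_map _ _ S' _ _ _ X Z om_XZ fr2 (fun h Sh => Sh)) succ.
  have [k' kk' ob'] := H _ _ ob; exists k'; first exact: leq_trans kk' _.
  apply: obtained_iso ob'; exists s; first by exists s.
  by move=> x y /=; rewrite /e1 !ss.
- have [b succ|nz] := pickP (fun b => success_prob iota (A b) (fun u => pos (val u))
      (normalize (collapse v b psi)) != 0); last first.
    rewrite big1 ?eqxx // => b _; have /negbFE/eqP -> := nz b.
    by rewrite mulr0.
  have [//|e1 [es1 [ei1 [xi1 [zeta1 [r fr1 zv]]]]]] :=
    measure_frame es ei v (P := bZ) (@stab_add _ _ _) fr.
  have [] := IH b _ (@adj_sym (@vertex_del (SGraph es1 ei1) v))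
    (@adj_irr (@vertex_del (SGraph es1 ei1) v)) _ _ _ _
    (framed_del es1 ei1 fr1 (fun h => stab_measure (b := b) _) zv) succ.
    by move=> _ <-; exists psi.
  move=> k kA ob _; exists k.
    by apply: leq_trans kA _; case: (b); rewrite ?leq_maxl ?leq_maxr.
  by apply: r; apply: ObtDel; exact: ob.
Qed.
End Forward.

(** The state is the uniform superposition with a controlled-Z sign for every edge. *)
Lemma graph_state_exists (C : numClosedFieldType) (G : sgraph) :
  exists psi : state C G, graph_state psi.
Proof.
(* Orienting each edge by the enumeration makes its sign occur once in the double product. *)
pose lt_adj (u w : G) := (enum_rank u < enum_rank w)%N && adj u w.
pose F (x : bits G) : C := \prod_u \prod_w (-1) ^+ [&& lt_adj u w, x u & x w].
pose phi : state C G := mk_state F.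
have phi_norm : sqnorm phi != 0.
  rewrite sqnormE; under eq_bigr => x _.
    rewrite amp_mk normr_prod big1 => [|u _]; last first.
      by rewrite normr_prod big1 // => w _; rewrite normrX normrN1 expr1n.
    rewrite expr1n; over.
  rewrite sumr_const pnatr_eq0 -lt0n; apply/card_gt0P; by exists [ffun=> false].
exists (normalize phi); split=> [|v]; first exact: sqnorm_normalize.
rewrite graph_stabilizerE weylZ; congr (_ *: _); apply: state_ext => x.
rewrite amp_weyl !amp_mk /F; set K := generator _ _ _ v.
have K1 u : (K u).1 = (u == v) by rewrite /K /generator; case: eqP => //; case: adj.
have K2 u : (K u).2 = adj v u.
  by rewrite /K /generator; case: eqP => [->|_]; [rewrite adj_irr|case: adj].
(* Flipping [v] affects only the edges at [v]; as there are no loops, the two ends are never both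
   flipped, and the change of sign depends on the other end alone. *)
have split_sign u w : (-1) ^+ [&& lt_adj u w, flip K x u & flip K x w] =
    (-1) ^+ [&& lt_adj u w, x u & x w] *
    ((-1) ^+ [&& u == v, lt_adj u w & x w] * (-1) ^+ [&& w == v, lt_adj u w & x u]) :> C.
  rewrite -!signr_addb !ffunE !K1; congr (_ ^+ nat_of_bool _).
  case E: (lt_adj u w); last by rewrite !andbF.
  have: u != w by apply: contraTneq E => ->; rewrite /lt_adj adj_irr andbF.
  case: (eqVneq u v) => [->|_]; case: (eqVneq w v) => [->|_] //=; rewrite ?eqxx //;
    by case: (x _); case: (x _).
have -> : \prod_u \prod_w (-1) ^+ [&& lt_adj u w, flip K x u & flip K x w] =
    (\prod_u \prod_w (-1) ^+ [&& lt_adj u w, x u & x w]) *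
    ((\prod_u \prod_w (-1) ^+ [&& u == v, lt_adj u w & x w]) *
     (\prod_u \prod_w (-1) ^+ [&& w == v, lt_adj u w & x u])) :> C.
  rewrite -!big_split; apply: eq_bigr => u _; rewrite -!big_split.
  by apply: eq_bigr => w _; exact: split_sign.
rewrite mulrCA -[RHS]mulr1; congr (_ * _).
rewrite [X in _ * (X * _)](bigD1 v) //= [X in _ * (_ * X * _)]big1 ?mulr1; last first.
  by move=> u /negPf uv; apply: big1 => w _; rewrite uv.
rewrite [X in _ * (_ * X)]exchange_big [X in _ * (_ * X)](bigD1 v) //=.
rewrite [X in _ * (_ * (_ * X))]big1 ?mulr1; last first.
  by move=> u /negPf uv; apply: big1 => w _; rewrite uv.
(* Each neighbour [u] of [v] gives a sign through exactly one orientation of the edge, which cancels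
   the sign from Z at [u]. *)
rewrite /wsign -!big_split big1 // => u _ /=; rewrite -!signr_addb K2 eqxx.
rewrite [X in _ ^+ nat_of_bool X](_ : _ = false) //.
rewrite /lt_adj (adj_sym u v) /=; case vu: (adj v u); last by rewrite !andbF.
case: (x u); rewrite ?andbF ?andbT //=.
case: ltngtP => //= /val_inj/enum_rank_inj E.
by rewrite E adj_irr in vu.
Qed.

(** * From graph operations to algorithms *)

Section Gates.
Variable C : numClosedFieldType.

Lemma oper_ext (V : finType) (A B : oper C V) :
  (forall phi : state C V, A *m phi = B *m phi) -> A = B.
Proof.
move=> E; apply/matrixP => i j.
have := congr1 (fun M : state C V => M i 0) (E (delta_mx j 0)).
by rewrite -!colE !mxE.
Qed.

(** The group must be mapped onto itself: involutivity of [M] supplies preimages, and [a ^+ 4 = 1]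
    keeps the scalars among the allowed phases. *)
Lemma clifford_of_involution k (U : oper C 'I_k)
    (M : ('I_k -> pauli_bits) -> 'I_k -> pauli_bits) :
  U \is unitarymx -> involutive M ->
  (forall g, exists2 a : C, a ^+ 4 = 1 &
    forall phi, U *m weyl g phi = a *: weyl (M g) (U *m phi)) ->
  clifford_group U.
Proof.
move=> Uu MK HU; split=> // B.
pose M' h i := bits_to_pauli (M (fun j => pauli_to_bits (h j)) i).
have M'K h : M' (M' h) = h.
  apply: funext => i; rewrite /M' -[RHS]pauli_to_bitsK; congr bits_to_pauli.
  rewrite (_ : (fun j => _) = M (fun j => pauli_to_bits (h j))) ?MK //.
  by apply: funext => j; rewrite bits_to_pauliK.
have conj h : exists2 a : C, a ^+ 4 = 1 &
    U *m pauli_tensor C h *m U^t* = a *: pauli_tensor C (M' h).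
  have [a a4 Ha] := HU (fun j => pauli_to_bits (h j)).
  exists (pauli_phase C h * a * (pauli_phase C (M' h))^-1).
    by rewrite !exprMn exprVn !pauli_phase4 a4 invr1 !mulr1.
  suff -> : U *m pauli_tensor C h =
      (pauli_phase C h * a * (pauli_phase C (M' h))^-1) *: pauli_tensor C (M' h) *m U.
    by rewrite mulmxtVK.
  apply: oper_ext => phi; rewrite -scalemxAl -mulmxA pauli_tensorE -scalemxAr Ha.
  rewrite -scalemxAl -mulmxA pauli_tensorE !scalerA mulfVK ?pauli_phase_neq0 //.
  by congr (_ *: weyl _ _); apply: funext => i; rewrite /M' bits_to_pauliK.
split=> [[a a4 [h ->]]|[_ [a a4 [h ->]] ->]].
  have [b b4 Eb] := conj (M' h); rewrite M'K in Eb.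
  have b0 : b != 0 by apply: contra_eq_neq b4 => ->; rewrite expr0n eq_sym oner_eq0.
  exists ((a / b) *: pauli_tensor C (M' h)).
    exists (a / b); last by exists (M' h).
    move: a4; rewrite !mem_phase => /eqP a4.
    by rewrite exprMn exprVn a4 b4 invr1 mulr1.
  by rewrite -scalemxAr -scalemxAl Eb scalerA mulfVK.
have [b b4 Eb] := conj h; exists (a * b).
  by move: a4; rewrite !mem_phase exprMn b4 mulr1.
by exists (M' h); rewrite -scalemxAr -scalemxAl Eb scalerA.
Qed.

Definition diag_gate (V : finType) (d : bits V -> C) : oper C V :=
  diag_mx (\row_i d (enum_val i)).

Lemma amp_diag_gate (V : finType) (d : bits V -> C) (phi : state C V) x :
  amp (diag_gate d *m phi) x = d x * amp phi x.
Proof. by rewrite /amp mul_diag_mx !mxE enum_rankK. Qed.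

Lemma diag_gate_unitary (V : finType) (d : bits V -> C) :
  (forall x, `|d x| = 1) -> diag_gate d \is unitarymx.
Proof.
move=> d1; apply/unitarymxP; rewrite tr_diag_mx map_diag_mx mulmx_diag.
apply/matrixP => i j; rewrite !mxE; case: eqP => // ->.
by rewrite -normCK d1 expr1n.
Qed.

Lemma amp_on_diag (V : finType) k (q : 'I_k -> V) (d : bits 'I_k -> C) psi x :
  injective q -> amp (on_qubits q (diag_gate d) *m psi) x = d (restr q x) * amp psi x.
Proof.
move=> q_inj; rewrite amp_on_qubits // amp_diag_gate amp_slice.
by rewrite overwrite_restr.
Qed.

Definition phase_gate : oper C 'I_1 := diag_gate (fun x => 'i ^+ x ord0).

Definition cz_gate : oper C 'I_2 :=
  diag_gate (fun x => (-1) ^+ (x ord0 && x ord_max)).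

Definition hadamard : oper C 'I_1 :=
  mk_oper (fun x y => (sqrtC 2)^-1 * (-1) ^+ (x ord0 && y ord0)).

Lemma phase_gate_weyl g phi : phase_gate *m weyl g phi =
  (if (g ord0).1 then - 'i else 1) *:
    weyl (fun i => ((g i).1, (g i).2 (+) (g i).1)) (phase_gate *m phi).
Proof.
apply: state_ext => x; rewrite ampZ amp_weyl !amp_diag_gate amp_weyl ffunE.
rewrite /wsign !big_ord_recl !big_ord0 !mulr1 /=.
have -> : flip (fun i => ((g i).1, (g i).2 (+) (g i).1)) x = flip g x.
  by apply/ffunP => i; rewrite !ffunE.
have ii : 'i * 'i = -1 :> C by rewrite -expr2 sqrCi.
rewrite !mulrA; congr (_ * _).
case: (g ord0) (x ord0) => [[] []] [] /=;
  by rewrite ?expr0 ?expr1 ?mulr1 ?mul1r ?mulrN1 ?mulNr ?mulrN ?mul1r ?ii ?opprK ?mulr1.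
Qed.

Lemma cz_gate_weyl g phi : cz_gate *m weyl g phi =
  (-1) ^+ ((g ord0).1 && (g ord_max).1) *:
    weyl (on_two ((g ord0) +b (g ord_max).1 *b bZ) ((g ord_max) +b (g ord0).1 *b bZ))
      (cz_gate *m phi).
Proof.
have e1 : lift ord0 (ord0 : 'I_1) = ord_max :> 'I_2 by apply: val_inj.
apply: state_ext => x; rewrite ampZ amp_weyl !amp_diag_gate amp_weyl.
have -> : flip (on_two ((g ord0) +b (g ord_max).1 *b bZ)
    ((g ord_max) +b (g ord0).1 *b bZ)) x = flip g x.
  apply/ffunP => i; rewrite !ffunE /on_two; case: eqP => [->|/eqP i0] /=.
    by rewrite andbF addbF.
  rewrite andbF addbF; congr (_ (+) (g _).1).
  by apply: val_inj; case: i i0 => [[|[]]].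
rewrite /wsign !big_ord_recl !big_ord0 !mulr1 !ffunE /= e1 /on_two /= !mulrA.
rewrite -!signr_addb; congr (_ ^+ nat_of_bool _ * _).
by case: (g ord0) (g ord_max) (x ord0) (x ord_max) => [[] []] [[] []] [] [].
Qed.

Definition bit1 (b : bool) : bits 'I_1 := [ffun=> b].

Lemma bit1E (x : bits 'I_1) : x = bit1 (x ord0).
Proof. by apply/ffunP => i; rewrite ffunE ord1. Qed.

Lemma amp_hadamard phi b : amp (hadamard *m phi) (bit1 b) =
  (sqrtC 2)^-1 * (amp phi (bit1 false) + (-1) ^+ b * amp phi (bit1 true)).
Proof.
rewrite amp_mul (reindex bit1) /=; last first.
  exists (fun x : bits 'I_1 => x ord0) => x _; first by rewrite ffunE.
  by rewrite -bit1E.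
rewrite big_bool /= !entry_mk !ffunE andbF andbT expr0 mulr1 mulrDr addrC.
by rewrite -mulrA.
Qed.

Lemma hadamard_weyl g phi : hadamard *m weyl g phi =
  (-1) ^+ ((g ord0).1 && (g ord0).2) *:
    weyl (fun i => ((g i).2, (g i).1)) (hadamard *m phi).
Proof.
have wE h b : wsign C h (bit1 b) = (-1) ^+ ((h ord0).2 && b).
  by rewrite /wsign big_ord_recl big_ord0 mulr1 ffunE.
have fE h b : flip h (bit1 b) = bit1 (b (+) (h ord0).1).
  by apply/ffunP => i; rewrite !ffunE ord1.
apply: state_ext => x; rewrite (bit1E x) ampZ amp_weyl wE fE /= !amp_hadamard.
rewrite !amp_weyl !wE !fE; set s := (sqrtC 2)^-1.
by case: (g ord0) (x ord0) => [[] []] [] /=; rewrite ?expr0 ?expr1; ring.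
Qed.

Lemma hadamard_unitary : hadamard \is unitarymx.
Proof.
have two0 : 2 != 0 :> C by rewrite pnatr_eq0.
have Hadj : hadamard^t* = hadamard.
  apply/matrixP => i j; rewrite !mxE andbC rmorphM rmorph_sign fmorphV.
  congr (_^-1 * _); apply/CrealP; by rewrite realE sqrtC_ge0 ler0n.
apply/unitarymxP; rewrite Hadj; apply: oper_ext => phi; rewrite mul1mx -mulmxA.
apply: state_ext => x; rewrite (bit1E x) !amp_hadamard.
set s := (sqrtC 2)^-1; have s2 : s * s * 2 = 1.
  by rewrite /s -invfM -expr2 sqrtCK mulVf.
transitivity (s * s * 2 * amp phi (bit1 (x ord0))); last by rewrite s2 mul1r.
by case: (x ord0); rewrite ?expr0 ?expr1; ring.
Qed.

Lemma phase_gate_unitary : phase_gate \is unitarymx.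
Proof. by apply: diag_gate_unitary => x; rewrite normrX normCi expr1n. Qed.

Lemma cz_gate_unitary : cz_gate \is unitarymx.
Proof. by apply: diag_gate_unitary => x; rewrite normrX normrN1 expr1n. Qed.

Lemma phase_clifford : clifford_group phase_gate.
Proof.
apply: (clifford_of_involution phase_gate_unitary
  (M := fun g i => ((g i).1, (g i).2 (+) (g i).1))).
  by move=> g; apply: funext => i; rewrite /= addbK -surjective_pairing.
move=> g; exists (if (g ord0).1 then - 'i else 1); last exact: phase_gate_weyl.
case: (g ord0).1; rewrite ?expr1n //.
by rewrite (exprM _ 2 2) sqrrN sqrCi sqrrN expr1n.
Qed.

Lemma hadamard_clifford : clifford_group hadamard.
Proof.
apply: (clifford_of_involution hadamard_unitary (M := fun g i => ((g i).2, (g i).1))).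
  by move=> g; apply: funext => i; rewrite /= -surjective_pairing.
move=> g; exists ((-1) ^+ ((g ord0).1 && (g ord0).2)); last exact: hadamard_weyl.
by case: (_ && _); rewrite ?expr0 ?expr1 ?expr1n // (exprM _ 2 2) sqrrN !expr1n.
Qed.

Lemma cz_clifford : clifford_group cz_gate.
Proof.
pose M (g : 'I_2 -> pauli_bits) := on_two
  ((g ord0) +b (g ord_max).1 *b bZ) ((g ord_max) +b (g ord0).1 *b bZ).
apply: (clifford_of_involution cz_gate_unitary (M := M)).
  move=> g; rewrite /M /on_two; apply: funext => i /=.
  case: eqP => [->|/eqP i0]; first by bool_ring.
  rewrite (_ : i = ord_max); first by bool_ring.
  by apply: val_inj; case: i i0 => [[|[]]].
move=> g; exists ((-1) ^+ ((g ord0).1 && (g ord_max).1)); last exact: cz_gate_weyl.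
by case: (_ && _); rewrite ?expr0 ?expr1 ?expr1n // (exprM _ 2 2) sqrrN !expr1n.
Qed.

Lemma phase_intertwines p :
  intertwines phase_gate (fun=> p) (fun=> local_map (true, true) bZ p).
Proof.
exists (if p.1 then - 'i else 1).
  by case: ifP; rewrite ?oner_eq0 // oppr_eq0 neq0Ci.
move=> phi; rewrite phase_gate_weyl; congr (_ *: weyl _ _).
by apply: funext => i; case: p => [[] []].
Qed.

Lemma hadamard_intertwines p :
  intertwines hadamard (fun=> p) (fun=> local_map bZ bX p).
Proof.
exists ((-1) ^+ (p.1 && p.2)); first by rewrite signr_eq0.
move=> phi; rewrite hadamard_weyl; congr (_ *: weyl _ _).
by apply: funext => i; case: p => [[] []].
Qed.

Lemma cz_intertwines p q : intertwines cz_gate (on_two p q)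
  (on_two (p +b omega q bZ *b bZ) (q +b omega p bZ *b bZ)).
Proof.
exists ((-1) ^+ (p.1 && q.1)); first by rewrite signr_eq0.
move=> phi; rewrite cz_gate_weyl; congr (_ *: weyl _ _).
by rewrite /on_two /=; apply: funext => i; case: p q => [[] []] [[] []].
Qed.

Definition pauli_at (V : finType) (v : V) (p : pauli_bits) : V -> pauli_bits :=
  fun x => if x == v then p else bI.

(** The Z gates of the sign corrections are obtained as squares of phase gates. *)
Lemma phase_twice (V : finType) (v : V) (psi : state C V) :
  on_qubit v phase_gate *m (on_qubit v phase_gate *m psi) = weyl (pauli_at v bZ) psi.
Proof.
have q_inj : injective (fun _ : 'I_1 => v) by move=> i j _; rewrite (ord1 i) (ord1 j).
apply: state_ext => x; rewrite !amp_on_diag // amp_weyl mulrA.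
congr (_ * _); last congr amp.
  rewrite /wsign (bigD1 v) //= big1 ?mulr1 => [|w /negPf wv]; last first.
    by rewrite /pauli_at wv.
  rewrite /pauli_at eqxx /= ffunE; case: (x v); rewrite ?expr1 ?mulr1 //.
  by rewrite -expr2 sqrCi.
by apply/ffunP => w; rewrite ffunE /pauli_at; case: eqP => _; rewrite addbF.
Qed.
End Gates.

(** * Algorithms for classes of states *)

Section Backward.
Variables (C : numClosedFieldType) (L : finType) (G : sgraph) (iota : G -> L).

Definition achieves (V : finType) (t : nat) (pos : V -> L) (Psi : state C V -> Prop) :=
  exists2 A : algorithm C V, (cz_complexity A <= t)%N &
    forall psi, Psi psi -> success_prob iota A pos psi = 1.

Section Register.
Variables (V : finType) (pos : V -> L).
Implicit Types (t : nat) (Psi : state C V -> Prop).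

Lemma achieves_sub t Psi Phi : (forall psi, Psi psi -> Phi psi) ->
  achieves t pos Phi -> achieves t pos Psi.
Proof. by move=> PP [A At HA]; exists A => // psi /PP/HA. Qed.

Lemma achieves1 t v (U : oper C 'I_1) Psi Phi : clifford_group U ->
  (forall psi, Psi psi -> Phi (on_qubit v U *m psi)) ->
  achieves t pos Phi -> achieves t pos Psi.
Proof.
by move=> cU PP [A At HA]; exists (Clifford1 v cU A) => //= psi /PP/HA.
Qed.

Lemma achieves2 t v w (U : oper C 'I_2) Psi Phi : v != w -> clifford_group U ->
  (forall psi, Psi psi -> Phi (on_pair v w U *m psi)) ->
  achieves t pos Phi -> achieves t.+1 pos Psi.
Proof.
by move=> vw cU PP [A At HA]; exists (Clifford2 vw cU A) => //= psi /PP/HA.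
Qed.
End Register.

(** Z at [v] anticommutes with the generator of [v] and with no other, so it flips exactly one sign;
    [r] lists the flips to undo, and only the parity of multiplicities matters. *)
Lemma achieves_signs (H : sgraph) t (pos : H -> L) (r : seq H) :
  achieves t pos (@graph_state C H) ->
  achieves t pos (fun psi : state C H => sqnorm psi = 1 /\
    forall u, weyl (generator (@adj H) (fun=> bX) (fun=> bZ) u) psi =
      (-1) ^+ count_mem u r *: psi).
Proof.
move=> ach; elim: r => [|v r IH].
  apply: achieves_sub ach => psi [n1 gs]; split=> // u.
  by rewrite graph_stabilizerE gs scale1r.
pose Z psi := on_qubit v (phase_gate C) *m psi : state C H.
apply: (achieves1 (v := v) (Phi := fun phi => exists2 psi, phi = Z psi &
    sqnorm psi = 1 /\
    forall u, weyl (generator (@adj H) (fun=> bX) (fun=> bZ) u) psi =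
      (-1) ^+ count_mem u (v :: r) *: psi) (phase_clifford C)).
  by move=> psi Ppsi; exists psi.
apply: (achieves1 (phase_clifford C) (v := v) _ IH) => _ [psi -> [n1 gs]].
rewrite /Z phase_twice; split.
  rewrite -phase_twice !sqnorm_on_qubits // ?phase_gate_unitary //;
    by move=> i j _; rewrite (ord1 i) (ord1 j).
move=> u; rewrite weyl_comm gs weylZ scalerA /= exprD mulrA; congr (_ *: _).
rewrite -[(v == u : nat)]/(nat_of_bool (v == u)).
have -> : vomega (generator (@adj H) (fun=> bX) (fun=> bZ) u) (pauli_at v bZ) = (v == u).
  rewrite (@vomega_split _ [set v]) ?big_set1 => [|x].
    rewrite /generator /pauli_at eqxx; case: (v == u) => //.
    by rewrite omegaZl andbF.
  by rewrite inE /pauli_at => /negPf ->; rewrite -[bI]/(false *b bI) omegaZr.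
by rewrite -signr_addb addbb expr0 mul1r.
Qed.

Lemma weyl_generatorK (H : sgraph) u (psi : state C H) :
  let K := generator (@adj H) (fun=> bX) (fun=> bZ) u in weyl K (weyl K psi) = psi.
Proof.
move=> K; rewrite weyl_weyl big1 ?scale1r => [|v _].
  rewrite (_ : vaddb K K = fun=> bI) ?weyl0 //.
  by apply: funext => v; rewrite /vaddb /paddb !addbb.
by rewrite /K /generator; case: (v == u) => //=; rewrite !andbF.
Qed.

(** Each generator squares to the identity, so its eigenvalue, common to the class [Psi], is 1 or
    -1; the vertices with -1 are passed to [achieves_signs]. *)
Lemma achieves_framed (H : sgraph) t (pos : H -> L) (Psi : state C H -> Prop) :
  achieves t pos (@graph_state C H) -> (forall psi, Psi psi -> sqnorm psi = 1) ->
  framed (stab Psi) (@adj H) (fun=> bX) (fun=> bZ) -> achieves t pos Psi.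
Proof.
(* For an empty class any algorithm will do, here [Stop]. *)
move=> ach n1 [_ SK]; have [[psi0 Ppsi0]|nP] := pselect (exists psi, Psi psi); last first.
  by exists (Stop _ _) => // psi Ppsi; case: nP; exists psi.
pose K := generator (@adj H) (fun=> bX) (fun=> bZ).
pose s u := `[< forall psi, Psi psi -> weyl (K u) psi = - psi >].
apply: (achieves_sub _ (achieves_signs [seq u <- enum H | s u] ach)) => psi Ppsi.
split=> [|u]; first exact: n1.
rewrite (count_uniq_mem _ (filter_uniq _ (enum_uniq _))) mem_filter mem_enum andbT.
rewrite /s; case: asboolP => [->|nsu]; rewrite ?expr1 ?scaleN1r ?scale1r //.
have [a Ha] := SK u; have := weyl_generatorK u psi0; rewrite /=.
rewrite !(Ha psi0 Ppsi0) weylZ (Ha psi0 Ppsi0) scalerA -[RHS]scale1r => /eqP.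
rewrite -subr_eq0 -scalerBl scaler_eq0 orbC.
have psi00 : psi0 != 0.
  by apply: contra_eq_neq (n1 _ Ppsi0) => ->; rewrite sqnorm0 eq_sym oner_eq0.
rewrite (negPf psi00) /= subr_eq0 -expr2 sqrf_eq1 => /orP[/eqP a1|/eqP a1].
  by rewrite Ha // a1 scale1r.
by case: nsu => phi Pphi; rewrite Ha // a1 scaleN1r.
Qed.

(** The class of states enters only through the graph and its frame, so gates can be followed by
    their effect on the frame. *)
Definition reaches (H : sgraph) t (pos : H -> L) (xi zeta : H -> pauli_bits) :=
  forall Psi : state C H -> Prop, (forall psi, Psi psi -> sqnorm psi = 1) ->
    framed (stab Psi) (@adj H) xi zeta -> achieves t pos Psi.

Definition map_at (V : finType) (v : V) (f : pauli_bits -> pauli_bits)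
    (h : V -> pauli_bits) : V -> pauli_bits := fun x => if x == v then f (h x) else h x.

Lemma on_qubit_framed (V : finType) (v : V) (U : oper C 'I_1) X Z
    (Psi Phi : state C V -> Prop) e xi zeta :
  omega X Z -> (forall p, intertwines U (fun=> p) (fun=> local_map X Z p)) ->
  (forall phi, Phi phi -> exists2 psi, Psi psi & phi = on_qubit v U *m psi) ->
  framed (stab Psi) e xi zeta ->
  framed (stab Phi) e (map_at v (local_map X Z) xi) (map_at v (local_map X Z) zeta).
Proof.
move=> XZ HU PhiE fr.
have mE h : map_at v (local_map X Z) h = fun x =>
    local_map (if x == v then X else bX) (if x == v then Z else bZ) (h x).
  by apply: funext => x; rewrite /map_at; case: eqP => // _; rewrite local_map_id.
rewrite !mE; apply: framed_local_map fr _ => [x|h]; first by case: eqP.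
apply: (@stab_on_qubits _ _ _ (fun _ : 'I_1 => v) _ U Psi).
- by move=> i j _; rewrite (ord1 i) (ord1 j).
- have := HU (h v); congr (intertwines _ _ _).
  by apply: funext => i /=; rewrite eqxx.
- move=> x xv; case: eqP => [E|_]; last by rewrite local_map_id.
  by rewrite E (codom_f (fun _ : 'I_1 => v) ord0) in xv.
- by [].
Qed.

Lemma reaches1 (H : sgraph) t (pos : H -> L) (v : H) (U : oper C 'I_1) X Z xi zeta :
  clifford_group U -> omega X Z ->
  (forall p, intertwines U (fun=> p) (fun=> local_map X Z p)) ->
  reaches t pos (map_at v (local_map X Z) xi) (map_at v (local_map X Z) zeta) ->
  reaches t pos xi zeta.
Proof.
move=> cU XZ HU R Psi n1 fr.
pose Phi phi := exists2 psi, Psi psi & phi = on_qubit v U *m psi.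
apply: (achieves1 (Phi := Phi) cU); first by move=> psi Ppsi; exists psi.
apply: R => [_ [psi Ppsi ->]|].
  rewrite sqnorm_on_qubits ?n1 ?cU.1 // => i j _; by rewrite (ord1 i) (ord1 j).
by apply: on_qubit_framed XZ HU _ fr.
Qed.

(* Each of the six frames is undone by a word in the Hadamard and phase gates. *)
Lemma reaches_fix (H : sgraph) t (pos : H -> L) (v : H) xi zeta :
  omega (xi v) (zeta v) ->
  reaches t pos (map_at v (fun=> bX) xi) (map_at v (fun=> bZ) zeta) ->
  reaches t pos xi zeta.
Proof.
have mm f g h : map_at v f (map_at v g h) = map_at v (f \o g) h.
  by apply: funext => x; rewrite /map_at; case: eqP.
have mE f h p : f (h v) = p -> map_at v f h = map_at v (fun=> p) h.
  by move=> E; apply: funext => x; rewrite /map_at; case: eqP => // ->.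
have had xi' zeta' := reaches1 (xi := xi') (zeta := zeta')
  (t := t) (pos := pos) (v := v)
  (hadamard_clifford C) (isT : omega bZ bX) (hadamard_intertwines C).
have pha xi' zeta' := reaches1 (xi := xi') (zeta := zeta')
  (t := t) (pos := pos) (v := v)
  (phase_clifford C) (isT : omega (true, true) bZ) (phase_intertwines C).
case xv: (xi v) => [[] []]; case zv: (zeta v) => [[] []] // _ R.
- by apply: had; apply: pha; rewrite !mm (mE _ xi bX) ?xv // (mE _ zeta bZ) ?zv.
- by apply: pha; rewrite (mE _ xi bX) ?xv // (mE _ zeta bZ) ?zv.
- by apply: (had _ _); apply: pha; apply: had;
    rewrite !mm (mE _ xi bX) ?xv // (mE _ zeta bZ) ?zv.
- move: R; rewrite -(mE id xi bX) ?xv // -(mE id zeta bZ) ?zv //.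
  have idE h : map_at v id h = h by apply: funext => x; rewrite /map_at; case: eqP.
  by rewrite !idE.
- by apply: pha; apply: had; rewrite !mm (mE _ xi bX) ?xv // (mE _ zeta bZ) ?zv.
- by apply: had; rewrite (mE _ xi bX) ?xv // (mE _ zeta bZ) ?zv.
Qed.

(** Single-qubit gates are free, so [reaches_fix] can reset the frame to X, Z one qubit at a
    time. *)
Lemma graph_state_reaches (H : sgraph) t (pos : H -> L) xi zeta :
  (forall v, omega (xi v) (zeta v)) -> achieves t pos (@graph_state C H) ->
  reaches t pos xi zeta.
Proof.
move=> om_xz ach.
suff R (r : seq H) : (forall v, v \notin r -> xi v = bX /\ zeta v = bZ) ->
    reaches t pos xi zeta.
  by apply: (R (enum H)) => v; rewrite mem_enum.
elim: r xi zeta om_xz => [|v r IH] xi zeta om_xz out.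
  have -> : xi = fun=> bX by apply: funext => v; case: (out v isT).
  have -> : zeta = fun=> bZ by apply: funext => v; case: (out v isT).
  by move=> Psi n1 fr; exact: achieves_framed.
apply: (reaches_fix (om_xz v)); apply: IH => [x|x xr].
  by rewrite /map_at; case: eqP.
by rewrite /map_at; case: eqP => // /eqP xv; apply: out; rewrite inE negb_or xv.
Qed.

Lemma sqnorm_on_pair (V : finType) (v w : V) (U : oper C 'I_2) (psi : state C V) :
  v != w -> U \is unitarymx -> sqnorm (on_pair v w U *m psi) = sqnorm psi.
Proof.
by move=> vw; apply: sqnorm_on_qubits; exact: pair_inj.
Qed.

(** Controlled-Z is the [cgate] with P = Q = Z, so [framed_gate] applies once the frame members
    selected by [a] and [b] are Z. *)
Lemma reaches_cz (V : finType) e (es : symmetric e) (ei : irreflexive e) t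
    (pos : V -> L) (v w : V) (a b : bool) F (xi zeta : V -> pauli_bits) :
  let H := SGraph es ei in
  v != w -> ~~ [&& a, b & e v w] -> toggles (part a (v : H)) (part b (w : H)) F ->
  (if a then xi v else zeta v) = bZ -> (if b then xi w else zeta w) = bZ ->
  achieves t pos (@graph_state C (@edge_compl H F)) ->
  @reaches H t.+1 pos xi zeta.
Proof.
move=> H vw nvw FE Ev Ew ach Psi n1 fr.
pose Phi phi := exists2 psi, Psi psi & phi = on_pair v w (cz_gate C) *m psi.
apply: (achieves2 (Phi := Phi) vw (cz_clifford C)); first by move=> psi; exists psi.
apply: (@graph_state_reaches (@edge_compl H F) t pos xi zeta fr.1 ach Phi)
  => [_ [psi Ppsi ->]|].
  by rewrite sqnorm_on_pair ?n1 ?cz_gate_unitary.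
apply: (framed_gate (es := es) (ei := ei) (@stab_add _ _ _) fr vw nvw) => [x y xy|h].
  by rewrite adj_edge_compl xy FE.
rewrite Ev Ew; pose q (i : 'I_2) := if i == ord0 then v else w.
apply: (@stab_on_qubits _ _ _ q _ (cz_gate C) Psi).
- exact: pair_inj.
- have := cz_intertwines C (h v) (h w).
  congr (intertwines _ _ _); apply: funext => i; rewrite /on_two /q /=.
    by case: ifP.
  have wv : (w == v) = false by rewrite eq_sym (negPf vw).
  by rewrite /cgate; case: ifP => _; rewrite ?eqxx ?wv ?(negPf vw); bool_ring.
- move=> x xvw; have [xv xw] : (x == v) = false /\ (x == w) = false.
    split; apply: contraNF xvw => /eqP ->; apply/codomP.
      by exists ord0.
    by exists ord_max.
  by rewrite /cgate xv xw; bool_ring.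
- by [].
Qed.

End Backward.

(** After a measurement, positions must be read in the initial register instead of the smaller one,
    that is, through the injection [val]. *)
Lemma success_prob_widen (C : numClosedFieldType) (L L' V : finType) (G : sgraph)
    (iota : G -> L') (j : L' -> L) (A : algorithm C V) (pos : V -> L') psi :
  injective j ->
  success_prob (j \o iota) A (j \o pos) psi = success_prob iota A pos psi.
Proof.
move=> jI; elim: A pos psi => {V}
  [V|V v U cU A IH|V v w U vw cU A IH|V v A IH] pos psi /=.
- congr (nat_of_bool _)%:R; apply: asbool_equiv_eq; split=> -[f [bf E gs]];
    exists f; split=> // v; have := E v; first exact: jI.
  by move=> /= ->.
- exact: IH.
- exact: IH.
- by apply: eq_bigr => b _; rewrite -IH.
Qed.

(** Deletions become measurements, local complementations only change the frame, and an elementary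
    complementation becomes one controlled-Z between single-qubit gates. *)
Lemma obtained_achieves (C : numClosedFieldType) k (H G : sgraph) : obtained k H G ->
  exists2 iota : G -> H, injective iota & achieves iota k id (@graph_state C H).
Proof.
have fr H' : framed (stab (@graph_state C H')) (@adj H') (fun=> bX) (fun=> bZ).
  split=> // u; exists 1 => psi [_ gs].
  by rewrite -graph_stabilizerE gs scale1r.
elim=> {k H G} [H G [f bf Ef]|k H G v _ [iota iI ach]|k H G v _ [iota iI ach]|
  k H G F elF _ [iota iI ach]].
- have [g fK gK] := bf; exists g; first exact: can_inj gK.
  exists (Stop _ _) => // psi [n1 gs] /=; case: asboolP => // -[].
  exists f; split=> //; split=> [|v]; first by rewrite sqnorm_rename.
  rewrite graph_stabilizerE -rename_weyl // -[in RHS](gs (g v)) graph_stabilizerE.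
  congr (rename f (weyl _ _)); apply: funext => x.
  by rewrite /generator /= -{1 2}(gK v) (inj_eq (can_inj fK)) Ef.
- case: H v iota iI ach => V e es ei v iota iI ach.
  exists (val \o iota); first exact: inj_comp val_inj iI.
  (* Impossible outcomes are excluded because [achieves_framed] asks for states of norm 1. *)
  pose Phi b phi := exists2 psi : state C (SGraph es ei),
    graph_state psi & phi = normalize (collapse v b psi) /\
    sqnorm (collapse v b psi) != 0.
  have ach' b : achieves iota k id (Phi b).
    apply: (achieves_framed ach) => [_ [psi _ [-> nz]]|].
      exact: sqnorm_normalize.
    apply: (framed_del (v := v) es ei (fr (SGraph es ei)) (P := bZ)); last by left.
    by move=> h; apply: (stab_measure (b := b)) => phi [psi gs [E _]]; exists psi.
  have [Af Akf Hf] := ach' false; have [At Akt Ht] := ach' true.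
  exists (Measure (fun b => if b then At else Af)) => /=; first by rewrite geq_max Akf.
  (* The outcome probabilities add up to the squared norm 1, and every possible outcome continues
     with success probability 1. *)
  move=> psi gs; rewrite -[RHS]gs.1 -(sqnorm_collapse v); apply: eq_bigr => b _.
  have [->|nz] := eqVneq (sqnorm (collapse v b psi)) 0; first by rewrite mul0r.
  rewrite (success_prob_widen iota _ id _ val_inj).
  have Pb : Phi b (normalize (collapse v b psi)) by exists psi.
  by case: b nz Pb => _ Pb; rewrite ?Ht ?Hf ?mulr1.
- exists iota => //; case: H v iota iI ach => V e es ei v iota iI ach.
  have frl := @framed_local V _ e es ei v _ _ (@stab_add _ _ _) (fr (SGraph es ei)).
  apply: (@graph_state_reaches C V G iota (local_compl v) k id _ _ frl.1 ach
    (@graph_state C (SGraph es ei))) => [psi []//|].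
  exact: frl.
- exists iota => //; case: H F elF iota iI ach => V e es ei F elF iota iI ach.
  have [v [w [a [b [vw nvw FE]]]]] := elementary_toggles elF.
  suff: @reaches C _ _ iota (SGraph es ei) k.+1 id (fun=> bX) (fun=> bZ).
    by apply => [psi []|]; [|exact: fr].
  have cz xi zeta Ev Ew :=
    reaches_cz (xi := xi) (zeta := zeta) vw nvw FE Ev Ew ach.
  have had u xi zeta := @reaches1 C V G iota (SGraph es ei) k.+1 id u _ _ _ xi zeta
    (hadamard_clifford C) (isT : omega bZ bX) (hadamard_intertwines C).
  have wv : (w == v) = false by rewrite eq_sym (negPf vw).
  (* Where [a] or [b] selects xi = X, a Hadamard gate first turns it into Z, as [reaches_cz]
     requires. *)
  case: a b {nvw FE} cz => [] [] cz.
  + apply: (had v); apply: (had w); apply: cz;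
      by rewrite /map_at ?eqxx ?wv ?(negPf vw).
  + by apply: (had v); apply: cz; rewrite /map_at ?eqxx ?wv ?(negPf vw).
  + by apply: (had w); apply: cz; rewrite /map_at ?eqxx ?wv ?(negPf vw).
  + exact: cz.
Qed.

Theorem theorem3 (R : realType) (G H : sgraph) (t : nat) :
  generated R[i] t H G <-> obtainable t H G.
Proof.
split=> [[iota [iI [A [At HA]]]]|[k kt ob]]; last first.
  have [iota iI [A Ak HA]] := obtained_achieves R[i]%type ob.
  by exists iota; split=> //; exists A; split=> //; exact: leq_trans Ak kt.
(* The success hypothesis is conditional on a graph state of [H], so one must be exhibited. *)
have [psi gs] := graph_state_exists R[i]%type H.
case: H iota iI A At HA psi gs => V e es ei iota iI A At HA psi gs.
have [|k kA ob] := success_obtained es ei (framed_graph_state gs)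
  (A := A) (iota := iota) (pos := id).
  by rewrite HA // oner_eq0.
by exists k => //; exact: leq_trans kA At.
Qed.
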